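(* Let $\mathcal{G}$ be a CGS, $\varphi$ an OGSL formula, $s\in\mathrm{St}$ a state, and $\chi$ an $s$-total assignment with $\mathrm{free}(\varphi)\subseteq\mathrm{dom}(\chi)$. Then $\mathcal{G},\chi,s\models\varphi$ iff $\mathcal{G},\chi,s\models_E\varphi$.
   Context: A CGS is $\langle \mathrm{AP}, \mathrm{Ag}, \mathrm{Ac}, \mathrm{St}, \lambda, \tau, s_0\rangle$ (finite non-empty atomic propositions and agents, non-empty actions and states, initial state, $\lambda:\mathrm{St}\to2^{\mathrm{AP}}$, $\tau:\mathrm{St}\times\mathrm{Ac}^{\mathrm{Ag}}\to\mathrm{St}$). Tracks: finite non-empty state sequences with consecutive states $\tau$-related; $\mathrm{Trk}(s)$ those starting at $s$. $\mathrm{Str}(s)=\mathrm{Trk}(s)\to\mathrm{Ac}$. Assignments: partial maps $\mathrm{Var}\cup\mathrm{Ag}\to$ strategies; $s$-total if values lie in $\mathrm{Str}(s)$; complete if defined on all agents; $\mathrm{Asg}(X,s)=X\to\mathrm{Str}(s)$. Translation $(f)_\rho(\rho')=f(\rho\cdot\rho'_{\ge1})$; $\mathrm{play}(\chi,s)$ path $\pi$ with $\pi_0=s$, $\pi_{i+1}=\tau(\pi_i,d_i)$, $d_i(a)=\chi(a)(\pi_0\cdots\pi_i)$; $(\chi,s)^i=((\chi)_{\pi_0\cdots\pi_i},\pi_i)$. SL: $\varphi ::= p\mid\neg\varphi\mid\varphi\wedge\varphi\mid\varphi\vee\varphi\mid X\varphi\mid\varphi U\varphi\mid\varphi R\varphi\mid\langle\langle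 x\rangle\rangle\varphi\mid[[x]]\varphi\mid(a,x)\varphi$; free agents/variables: atoms none; Boolean union; $X,U,R$ add all agents; quantifiers on $x$ remove $x$; $(a,x)\varphi$: $\mathrm{free}(\varphi)$ if $a\notin\mathrm{free}(\varphi)$, else $(\mathrm{free}(\varphi)\setminus\{a\})\cup\{x\}$. Classical semantics: $p$ iff $p\in\lambda(s)$; Boolean usual; $\langle\langle x\rangle\rangle\varphi$/$[[x]]\varphi$: some/all $f\in\mathrm{Str}(s)$ satisfy $\mathcal{G},\chi[x\mapsto f],s\models\varphi$; $(a,x)\varphi$ iff $\mathcal{G},\chi[a\mapsto\chi(x)],s\models\varphi$; $X,U,R$ for complete $\chi$ as in LTL along $(\chi,s)^i$. Quantification prefix over finite $V$: word over $\{\langle\langle x\rangle\rangle,[[x]]:x\in V\}$ with each $x\in V$ once ($\mathrm{Qnt}(V)$); $\mathcal{E}(\wp),\mathcal{U}(\wp)$ existential/universal variables; $\mathrm{Dep}(\wp,y)$ universal variables before existential $y$. Binding prefix: word of length $|\mathrm{Ag}|$ over pairs $(a,x)$ with each agent once. OGSL: $\varphi ::= p\mid\neg\varphi\mid\varphi\wedge\varphi\mid\varphi\vee\varphi\mid X\varphi\mid\varphi U\varphi\mid\varphi R\varphi\mid\wp\flat\varphi$ with $\wp\in\mathrm{Qnt}(\mathrm{free}(\flat\varphi))$. Dependence map for $\wp$ over $D$: $\theta:(\mathcal{U}(\wp)\to D)\to(V\to D)$ with $\theta(v)|_{\mathcal{U}(\wp)}=v$ and, for $x\in\mathcal{E}(\wp)$,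 $\theta(v_1)(x)=\theta(v_2)(x)$ whenever $v_1,v_2$ agree on $\mathrm{Dep}(\wp,x)$. Over $\mathrm{Str}(s)=\mathrm{Trk}(s)\to\mathrm{Ac}$, $\theta$ is elementary if there is $\tilde\theta:\mathrm{Trk}(s)\to((\mathcal{U}(\wp)\to\mathrm{Ac})\to(V\to\mathrm{Ac}))$ with $\tilde\theta(\rho)(\hat g(\rho))(x)=\theta(g)(x)(\rho)$ for all $g,x,\rho$, where $\hat g(\rho)(u)=g(u)(\rho)$. Elementary semantics $\models_E$: like $\models$ for atoms, Boolean connectives, temporal operators and bindings, while a subformula $\wp\psi$ (agent-closed $\psi$, $\wp\in\mathrm{Qnt}(\mathrm{free}(\psi))$, hence a sentence) holds at $s$ iff there is an elementary dependence map $\theta$ for $\wp$ over $\mathrm{Str}(s)$ with $\mathcal{G},\theta(\chi),s\models_E\psi$ for all $\chi\in\mathrm{Asg}(\mathcal{U}(\wp),s)$. *)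

(* Defs.v *)
From mathcomp Require Import all_boot.

Set Implicit Arguments.
Unset Strict Implicit.
Unset Printing Implicit Defensive.

(** * Concurrent game structures *)

Record CGS (AP Ag : finType) := MkCGS {
  Ac : Type;
  St : Type;
  lab : St -> {set AP};
  trans : St -> (Ag -> Ac) -> St;
  init : St;
  AP_nonempty : 0 < #|AP|;
  Ag_nonempty : 0 < #|Ag|;
  Ac_nonempty : inhabited Ac
}.

Arguments lab {AP Ag} c _.
Arguments trans {AP Ag} c _ _.

Section Strategies.
Context {AP Ag : finType} (G : CGS AP Ag).

(* [is_track s p]: the non-empty sequence [s :: p] is a track. *)
Fixpoint is_track (s : St G) (p : seq (St G)) : Prop :=
  if p is t :: p' then (exists d, trans G s d = t) /\ is_track t p' else True.

(* Trk(s): the leading state [s] is left implicit, so the underlying sequence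
   is the tail of the track. *)
Definition Trk (s : St G) := {p : seq (St G) | is_track s p}.

Definition lst (s : St G) (r : Trk s) : St G := last s (sval r).

Definition Str (s : St G) := Trk s -> Ac G.

Lemma is_track_cat s p q :
  is_track s p -> is_track (last s p) q -> is_track s (p ++ q).
Proof. by elim: p s => //= t p IH s [? ?] ?; split=> //; apply: IH. Qed.

(* r . r'_{>=1}, for a track r' starting where r ends *)
Definition trk_cat (s : St G) (r : Trk s) (r' : Trk (lst r)) : Trk s :=
  exist _ (sval r ++ sval r') (is_track_cat (proj2_sig r) (proj2_sig r')).

Definition str_shift (s : St G) (f : Str s) (r : Trk s) : Str (lst r) :=
  fun r' => f (trk_cat r').

Definition trk0 (s : St G) : Trk s := exist _ [::] I.

Definition trk1 (s : St G) (d : Ag -> Ac G) : Trk s :=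
  exist _ [:: trans G s d] (conj (ex_intro _ d erefl) I).

(* The prefix pi_0 ... pi_i of the play of the strategy profile [c] from [s];
   pi_i is [lst (play_prefix c i)]. *)
Fixpoint play_prefix (s : St G) (c : Ag -> Str s) (i : nat) : Trk s :=
  if i is j.+1 then
    let r := play_prefix c j in trk_cat (trk1 (lst r) (fun a => c a r))
  else trk0 s.

End Strategies.

Arguments Trk {AP Ag G} s.
Arguments Str {AP Ag G} s.
Arguments str_shift {AP Ag G s} f r _.

(** * Assignments *)

Section Assignments.
Context {AP Ag : finType} {Var : eqType} {G : CGS AP Ag}.

(* s-total partial assignments over Var \cup Ag *)
Definition asg (s : St G) := (Var + Ag)%type -> option (Str s).

Definition asg_dom (s : St G) (chi : asg s) : pred (Var + Ag) :=
  fun v => isSome (chi v).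

(* With [o = None] the updated assignment is undefined at [v]. *)
Definition asg_upd (s : St G) (chi : asg s) (v : Var + Ag)
    (o : option (Str s)) : asg s :=
  fun w => if w == v then o else chi w.

Definition asg_shift (s : St G) (chi : asg s) (r : Trk s) : asg (lst r) :=
  fun v => omap (fun f => str_shift f r) (chi v).

(* [chi] is complete, with [c] as its restriction to the agents. *)
Definition complete_by (s : St G) (chi : asg s) (c : Ag -> Str s) : Prop :=
  forall a, chi (inr a) = Some (c a).

(* [P] holds at (chi, s)^i, where [c] is the agents' part of [chi]. *)
Definition holds_at (P : forall t : St G, asg t -> Prop)
    (s : St G) (chi : asg s) (c : Ag -> Str s) (i : nat) : Prop :=
  P (lst (play_prefix c i)) (asg_shift chi (play_prefix c i)).

(* The temporal clauses are meaningful for complete assignments only; [c] is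
   then determined by [chi]. *)
Definition sem_next P (s : St G) (chi : asg s) : Prop :=
  exists c, complete_by chi c /\ holds_at P chi c 1.

Definition sem_until P Q (s : St G) (chi : asg s) : Prop :=
  exists c, complete_by chi c /\
    exists i, holds_at Q chi c i /\ forall j, j < i -> holds_at P chi c j.

Definition sem_release P Q (s : St G) (chi : asg s) : Prop :=
  exists c, complete_by chi c /\
    forall i, holds_at Q chi c i \/ exists j, j < i /\ holds_at P chi c j.

End Assignments.

Arguments asg {AP Ag} Var {G} s.

(** * Strategy Logic *)

Inductive SL (AP Ag : finType) (Var : eqType) :=
| Atom of AP
| Neg of SL AP Ag Var
| And of SL AP Ag Var & SL AP Ag Var
| Or of SL AP Ag Var & SL AP Ag Var
| Next of SL AP Ag Var
| Until of SL AP Ag Var & SL AP Ag Var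
| Release of SL AP Ag Var & SL AP Ag Var
| Exq of Var & SL AP Ag Var
| Allq of Var & SL AP Ag Var
| Bind of Ag & Var & SL AP Ag Var.

Arguments Atom {AP Ag Var} _.

Section Syntax.
Context {AP Ag : finType} {Var : eqType}.
Implicit Types phi psi : SL AP Ag Var.

Definition all_agents : seq (Var + Ag) := [seq inr a | a <- enum Ag].

Fixpoint free phi : seq (Var + Ag) :=
  match phi with
  | Atom _ => [::]
  | Neg phi => free phi
  | And phi psi | Or phi psi => free phi ++ free psi
  | Next phi => all_agents ++ free phi
  | Until phi psi | Release phi psi => all_agents ++ free phi ++ free psi
  | Exq x phi | Allq x phi => [seq v <- free phi | v != inl x]
  | Bind a x phi =>
      if inr a \in free phi
      then inl x :: [seq v <- free phi | v != inr a]
      else free phi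
  end.

End Syntax.

(** * Quantification and binding prefixes *)

Variant quantifier (Var : Type) := QEx of Var | QAll of Var.

Section Prefixes.
Context {Var : eqType}.
Implicit Types wp : seq (quantifier Var).

Definition qvar (q : quantifier Var) : Var :=
  match q with QEx x | QAll x => x end.

Definition qvars wp : seq Var := [seq qvar q | q <- wp].

Definition exvars wp : seq Var :=
  pmap (fun q => if q is QEx x then Some x else None) wp.

Definition univars wp : seq Var :=
  pmap (fun q => if q is QAll x then Some x else None) wp.

(* Only meant for y existential in wp. *)
Fixpoint dep wp (y : Var) : seq Var :=
  match wp with
  | [::] => [::]
  | QEx x :: wp' => if x == y then [::] else dep wp' y
  | QAll x :: wp' => x :: dep wp' y
  end.

Definition sub_of (X : seq Var) := {x : Var | x \in X}.

Definition dependence_map wp (D : Type)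
    (theta : (sub_of (univars wp) -> D) -> (sub_of (qvars wp) -> D)) : Prop :=
  (forall v (x : sub_of (qvars wp)) (u : sub_of (univars wp)),
     val x = val u -> theta v x = v u) /\
  (forall v1 v2 (x : sub_of (qvars wp)), val x \in exvars wp ->
     (forall u : sub_of (univars wp), val u \in dep wp (val x) -> v1 u = v2 u) ->
     theta v1 x = theta v2 x).

End Prefixes.

Section Elementary.
Context {AP Ag : finType} {Var : eqType} {G : CGS AP Ag}.

Definition elementary (wp : seq (quantifier Var)) (s : St G)
    (theta : (sub_of (univars wp) -> Str s) -> (sub_of (qvars wp) -> Str s)) :
    Prop :=
  exists adj : Trk s ->
      (sub_of (univars wp) -> Ac G) -> (sub_of (qvars wp) -> Ac G),
    forall g x r, adj r (fun u => g u r) x = theta g x r.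

Definition asg_of (X : seq Var) (s : St G) (f : sub_of X -> Str s) : asg Var s :=
  fun v => if v is inl x then omap f (insub x) else None.

Definition elementary_sem (P : forall t : St G, asg Var t -> Prop)
    (wp : seq (quantifier Var)) (s : St G) : Prop :=
  exists theta : (sub_of (univars wp) -> Str s) -> (sub_of (qvars wp) -> Str s),
    [/\ dependence_map theta, elementary theta &
      forall v : sub_of (univars wp) -> Str s, P s (asg_of (theta v))].

End Elementary.

(** * The one-goal fragment *)

Section OneGoal.
Context {AP Ag : finType} {Var : eqType}.

Definition quant (wp : seq (quantifier Var)) (psi : SL AP Ag Var) :=
  foldr (fun q => match q with QEx x => Exq x | QAll x => Allq x end) psi wp.

Definition bind (b : seq (Ag * Var)) (psi : SL AP Ag Var) :=
  foldr (fun p => Bind p.1 p.2) psi b.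

(* wp \in Qnt(V); as V is given as a subset of Var \cup Ag, this includes the
   requirement that V contain no agent. *)
Definition is_qnt (wp : seq (quantifier Var)) (V : seq (Var + Ag)) : Prop :=
  uniq (qvars wp) /\ [seq inl x | x <- qvars wp] =i V.

Definition is_bnd (b : seq (Ag * Var)) : Prop :=
  size b = #|Ag| /\ forall a, count_mem a (unzip1 b) = 1.

Inductive OGSL : SL AP Ag Var -> Prop :=
| OG_atom p : OGSL (Atom p)
| OG_neg phi : OGSL phi -> OGSL (Neg phi)
| OG_and phi psi : OGSL phi -> OGSL psi -> OGSL (And phi psi)
| OG_or phi psi : OGSL phi -> OGSL psi -> OGSL (Or phi psi)
| OG_next phi : OGSL phi -> OGSL (Next phi)
| OG_until phi psi : OGSL phi -> OGSL psi -> OGSL (Until phi psi)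
| OG_release phi psi : OGSL phi -> OGSL psi -> OGSL (Release phi psi)
| OG_goal wp b phi :
    OGSL phi -> is_bnd b -> is_qnt wp (free (bind b phi)) ->
    OGSL (quant wp (bind b phi)).

End OneGoal.

(** * Semantics *)

Section Semantics.
Context {AP Ag : finType} {Var : eqType} {G : CGS AP Ag}.

Fixpoint sat (phi : SL AP Ag Var) (s : St G) (chi : asg Var s) : Prop :=
  match phi with
  | Atom p => p \in lab G s
  | Neg phi => ~ sat phi chi
  | And phi psi => sat phi chi /\ sat psi chi
  | Or phi psi => sat phi chi \/ sat psi chi
  | Next phi => sem_next (@sat phi) chi
  | Until phi psi => sem_until (@sat phi) (@sat psi) chi
  | Release phi psi => sem_release (@sat phi) (@sat psi) chi
  | Exq x phi => exists f : Str s, sat phi (asg_upd chi (inl x) (Some f))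
  | Allq x phi => forall f : Str s, sat phi (asg_upd chi (inl x) (Some f))
  | Bind a x phi => sat phi (asg_upd chi (inr a) (chi (inl x)))
  end.

(* [satE_rec phi wp] is the elementary semantics of [wp phi]: the quantifiers
   heading a formula are collected in [wp] until the whole quantification
   prefix has been read.  When it is non-empty it is evaluated through an
   elementary dependence map.  For an empty prefix no map is needed; see
   [satE_goal] below for the fact that the dependence-map clause then holds as
   well. *)
Fixpoint satE_rec (phi : SL AP Ag Var) (wp : seq (quantifier Var))
    (s : St G) (chi : asg Var s) : Prop :=
  let close (P : forall t : St G, asg Var t -> Prop) :=
    if wp is [::] then P s chi else elementary_sem P wp s in
  let satE phi t (chi : asg Var t) := satE_rec phi [::] chi in
  match phi with
  | Exq x phi => satE_rec phi (rcons wp (QEx x)) chi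
  | Allq x phi => satE_rec phi (rcons wp (QAll x)) chi
  | Atom p => close (fun t _ => p \in lab G t)
  | Neg phi => close (fun t chi => ~ satE phi t chi)
  | And phi psi => close (fun t chi => satE phi t chi /\ satE psi t chi)
  | Or phi psi => close (fun t chi => satE phi t chi \/ satE psi t chi)
  | Next phi => close (fun t chi => sem_next (satE phi) chi)
  | Until phi psi => close (fun t chi => sem_until (satE phi) (satE psi) chi)
  | Release phi psi =>
      close (fun t chi => sem_release (satE phi) (satE psi) chi)
  | Bind a x phi =>
      close (fun t chi => satE phi t (asg_upd chi (inr a) (chi (inl x))))
  end.

Definition satE (phi : SL AP Ag Var) (s : St G) (chi : asg Var s) : Prop :=
  satE_rec phi [::] chi.

End Semantics.

Section SemanticsFacts.
Context {AP Ag : finType} {Var : eqType} {G : CGS AP Ag}.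

Let agree (X : seq (Var + Ag)) (s : St G) (chi1 chi2 : asg Var s) :=
  forall v, v \in X -> chi1 v = chi2 v.

Lemma satE_rec_cons (phi : SL AP Ag Var) q wp (s : St G) (chi1 chi2 : asg Var s) :
  satE_rec phi (q :: wp) chi1 = satE_rec phi (q :: wp) chi2.
Proof. by elim: phi wp => //= x phi IH wp; apply: IH. Qed.

Lemma complete_agree X (s : St G) (chi1 chi2 : asg Var s) c :
  agree (all_agents ++ X) chi1 chi2 -> complete_by chi1 c -> complete_by chi2 c.
Proof.
by move=> E C a; rewrite -E ?C // mem_cat map_f // mem_enum.
Qed.

Lemma holds_agree X P (s : St G) (chi1 chi2 : asg Var s) c i :
  (forall t (x1 x2 : asg Var t), agree X x1 x2 -> P t x1 -> P t x2) ->
  agree X chi1 chi2 -> holds_at P chi1 c i -> holds_at P chi2 c i.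
Proof. by move=> HP E; apply: HP => v /E; rewrite /asg_shift => ->. Qed.

Lemma satE_agree (phi : SL AP Ag Var) (s : St G) (chi1 chi2 : asg Var s) :
  agree (free phi) chi1 chi2 -> satE phi chi1 -> satE phi chi2.
Proof.
have sym X t (x1 x2 : asg Var t) : agree X x1 x2 -> agree X x2 x1.
  by move=> E v /E.
have aL X Y t (x1 x2 : asg Var t) : agree (X ++ Y) x1 x2 -> agree X x1 x2.
  by move=> E v vX; apply: E; rewrite mem_cat vX.
have aR X Y t (x1 x2 : asg Var t) : agree (X ++ Y) x1 x2 -> agree Y x1 x2.
  by move=> E v vX; apply: E; rewrite mem_cat vX orbT.
rewrite /satE.
elim: phi s chi1 chi2 => //=
  [phi IH|phi IH psi IH'|phi IH psi IH'|phi IH|phi IH psi IH'|phi IH psi IH'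
  |x phi _|x phi _|a x phi IH] s chi1 chi2 E.
- by move=> H /IH K; apply: H; apply: K; apply: sym.
- by case=> /(IH _ _ _ (aL _ _ _ _ _ E)) ? /(IH' _ _ _ (aR _ _ _ _ _ E)).
- by case=> [/(IH _ _ _ (aL _ _ _ _ _ E))|/(IH' _ _ _ (aR _ _ _ _ _ E))];
    [left|right].
- move=> [c [C H]]; exists c; split; first exact: complete_agree E C.
  exact: (holds_agree IH (aR _ _ _ _ _ E)).
- have /= E1 := aL _ _ _ _ _ (aR _ _ _ _ _ E).
  have /= E2 := aR _ _ _ _ _ (aR _ _ _ _ _ E).
  move=> [c [C [i [H1 H2]]]]; exists c; split; first exact: complete_agree E C.
  exists i; split; first exact: (holds_agree IH' E2).
  by move=> j /H2; apply: (holds_agree IH E1).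
- have /= E1 := aL _ _ _ _ _ (aR _ _ _ _ _ E).
  have /= E2 := aR _ _ _ _ _ (aR _ _ _ _ _ E).
  move=> [c [C H]]; exists c; split; first exact: complete_agree E C.
  move=> i; case: (H i) => [H1|[j [ji H1]]].
    by left; apply: (holds_agree IH' E2).
  by right; exists j; split=> //; apply: (holds_agree IH E1).
- by rewrite (satE_rec_cons phi (QEx x) [::] chi1 chi2).
- by rewrite (satE_rec_cons phi (QAll x) [::] chi1 chi2).
- apply: IH => v vphi; rewrite /asg_upd; case: eqP => [ev|/eqP nv].
    by apply: E; rewrite -ev vphi mem_head.
  by apply: E; case: ifP => // _; rewrite inE mem_filter nv vphi orbT.
Qed.

Lemma satE_rec_quant (psi : SL AP Ag Var) wp wp' (s : St G) (chi : asg Var s) :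
  satE_rec (quant wp psi) wp' chi = satE_rec psi (wp' ++ wp) chi.
Proof.
by elim: wp wp' => [|[] x wp IH] wp' /=; rewrite ?cats0 ?IH // cat_rcons.
Qed.

(* The elementary semantics of a goal [wp b phi] is the dependence-map clause
   for [wp], whether or not [wp] is empty. *)
Lemma satE_goal wp b (phi : SL AP Ag Var) (s : St G) (chi : asg Var s) :
  is_bnd b -> is_qnt wp (free (bind b phi)) ->
  satE (quant wp (bind b phi)) chi <-> elementary_sem (@satE _ _ _ G (bind b phi)) wp s.
Proof.
move=> [sb _] [_ Ewp]; rewrite /satE satE_rec_quant cat0s.
case: wp Ewp => [|q wp] Ewp; last first.
  by case: b sb {Ewp} => [|[a x] b] //= sb; have := Ag_nonempty G; rewrite -sb.
have nF (x1 x2 : asg Var s) : agree (free (bind b phi)) x1 x2.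
  by move=> v; rewrite -Ewp.
split=> [H|[theta [_ _ H]]].
- exists (fun v => v); split=> [||v].
  + by split=> [v [x xP]|v1 v2 [x xP]]; have := xP; rewrite in_nil.
  + by exists (fun _ v => v).
  + by apply: satE_agree H; apply: nF.
- have f0 : sub_of (univars ([::] : seq (quantifier Var))) -> Str s.
    by case=> x; rewrite in_nil.
  by apply: satE_agree (H f0); apply: nF.
Qed.

End SemanticsFacts.

(* Main.v *)
Require Import Defs.
From mathcomp Require Import all_boot.
From Stdlib Require Import Classical ClassicalEpsilon FunctionalExtensionality.

Set Implicit Arguments.
Unset Strict Implicit.
Unset Printing Implicit Defensive.

(** An elementary dependence map is a family of Skolem functions for the prefix
    over actions, one for each track.  A goal thus gives rise to a game on
    tracks in which [E q X], the prefix read over actions, says that the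
    existential side can force the successor of the track [q] into [X].  Its
    winning strategies are the elementary dependence maps that realise the goal;
    those of the opponent are elementary maps for the dual prefix, and these
    refute the goal classically.  So everything rests on determinacy.

    The winning condition is an LTL property of the state sequence, state
    subformulas being sentences.  It is recognised by a backward deterministic
    automaton with exactly one fair run on every word, and the finiteness of the
    set of block colourings then makes it a Sigma^0_3 set, by Shelah's merging of
    positions.  Davis' proof of Sigma^0_3 determinacy applies to the games
    given by the functions [E]. *)

Lemma fun_choice (A B : Type) (R : A -> B -> Prop) :
  (forall x, exists y, R x y) -> exists f, forall x, R x (f x).
Proof.
move=> H; exists (fun x => proj1_sig (constructive_indefinite_description _ (H x))).
by move=> x; apply: proj2_sig.
Qed.
Arguments fun_choice [A B] R _.

(** * Determinacy *)

Section Determinacy.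
Variables (X : Type) (E : seq X -> (X -> Prop) -> Prop).
Hypothesis E_mono : forall q (P Q : X -> Prop),
  (forall t, P t -> Q t) -> E q P -> E q Q.
Hypothesis E_top : forall q, E q (fun=> True).

Fixpoint hist (x : nat -> X) n := if n is m.+1 then x m :: hist x m else [::].

Lemma size_hist x n : size (hist x n) = n.
Proof. by elim: n => //= n ->. Qed.

Implicit Types (T S : seq X -> Prop) (A : (nat -> X) -> Prop).

(* Histories list the latest state first.  A strategy is the set [S] of the
   histories it allows; [T] constrains the opponent.  Quantifying over all [n0]
   makes [S] winning from each of its members. *)
Definition strategy T A S :=
  (forall q, S q -> T q -> E q (fun t => T (t :: q) -> S (t :: q))) /\
  (forall x n0, (forall n, n0 <= n -> S (hist x n) /\ T (hist x n)) -> A x).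

Definition wins T A p := exists S, strategy T A S /\ S p.

Lemma wins_choice T A :
  exists W : seq X -> seq X -> Prop,
    forall q, wins T A q -> strategy T A (W q) /\ W q q.
Proof.
apply: (fun_choice (fun q S => wins T A q -> strategy T A S /\ S q)) => q.
by case: (classic (wins T A q)) => [[S HS]|nW]; [exists S | exists (fun=> True)].
Qed.

(** A strategy is a set of histories, so memory comes for free: it is recomputed from the part of
    the history that follows [p]. Strategies that switch between other strategies are built with
    this lemma. *)
Lemma wins_memory T A (M : Type) (upd : M -> seq X -> M)
    (R : M -> seq X -> Prop) m0 p :
  R m0 p ->
  (forall m q, size p <= size q -> R m q -> T q ->
     E q (fun t => T (t :: q) -> R (upd m (t :: q)) (t :: q))) ->
  (forall x (m : nat -> M), hist x (size p) = p -> m (size p) = m0 ->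
     (forall n, size p <= n -> m n.+1 = upd (m n) (hist x n.+1)) ->
     (forall n, size p <= n -> R (m n) (hist x n) /\ T (hist x n)) -> A x) ->
  wins T A p.
Proof.
move=> R0 Rstep Rplay.
(* [memo] replays [upd] along the states after [p]; [ok] says that all these steps respected [R] and
   [T]. Among the histories not longer than [p], only [p] itself is in [ok]. *)
pose memo := fix memo q := if size q <= size p then m0 else
  if q is t :: q' then upd (memo q') q else m0.
pose ok := fix ok q := if size q <= size p then q = p else
  if q is t :: q' then [/\ ok q', T q' & R (memo q) q] else False.
have memoS t q : size p <= size q -> memo (t :: q) = upd (memo q) (t :: q).
  by move=> le /=; rewrite ltnNge le.
have okS t q : size p <= size q ->
    ok (t :: q) = [/\ ok q, T q & R (memo (t :: q)) (t :: q)].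
  by move=> le /=; rewrite ltnNge le.
have ok0 q : size q <= size p -> ok q = (q = p).
  by case: q => [|t q] //=; move=> ->.
have ok_p q : size q <= size p -> ok q -> q = p by move=> /ok0 ->.
have okp : ok p by rewrite ok0.
have memop q : size q <= size p -> memo q = m0.
  by case: q => [|t q] //=; move=> ->.
have ok_size q : ok q -> size p <= size q.
  by case: (leqP (size q) (size p)) => [le /(ok_p _ le) -> //|/ltnW].
have okR q : ok q -> R (memo q) q.
  move=> oq; have le := ok_size _ oq.
  case: (leqP (size q) (size p)) => [le'|].
    by rewrite (ok_p _ le' oq) memop.
  by case: q oq le => // t q oq _ lt; move: oq; rewrite okS //; case.
exists ok; split=> //; split=> [q oq Tq|x n0 H].
  have le := ok_size _ oq.
  apply: E_mono (Rstep _ _ le (okR _ oq) Tq) => t RT Tt.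
  by rewrite okS //; split=> //; rewrite memoS //; apply: RT.
have okH i : size p <= i -> ok (hist x i.+1) -> ok (hist x i) /\ T (hist x i).
  by move=> le; rewrite [hist x _.+1]/= okS ?size_hist // => -[].
(* The play is only known to be in [ok] from [n0] on, but [ok] descends to shorter histories as far
   as [p]. *)
have Hx n : size p <= n -> ok (hist x n) /\ T (hist x n).
  move=> le; have: ok (hist x (n + n0.+1)).
    by apply: (H _ _).1; rewrite addnS leqW // leq_addl.
  elim: n0 {H} => [|k IH]; first by rewrite addn1; apply: okH.
  rewrite addnS => /okH[|ok' _]; last exact: IH.
  exact: leq_trans le (leq_addr _ _).
apply: (Rplay x (fun n => memo (hist x n))).
- by apply: ok_p; [rewrite size_hist | apply: (Hx _ _).1].
- by apply: memop; rewrite size_hist.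
- by move=> n le; rewrite memoS ?size_hist.
- by move=> n le; split; [apply/okR/(Hx _ le).1 | apply: (Hx _ le).2].
Qed.

Lemma wins_all T A p : (forall x, hist x (size p) = p -> A x) -> wins T A p.
Proof.
move=> H; apply: (@wins_memory _ _ unit (fun _ _ => tt) (fun _ _ => True) tt)
  => [//|m q _ _ _|x m].
- by apply: E_mono (E_top q).
- by move=> /H.
Qed.

(** The first successor is stored in the memory, and its own winning strategy is followed from then
    on. *)
Lemma wins_step T A p :
  E p (fun t => T (t :: p) -> wins T A (t :: p)) -> wins T A p.
Proof.
move=> H; have [W WP] := wins_choice T A.
pose upd (m : option (seq X)) q := if m is Some q0 then Some q0 else Some q.
pose R m q := if m is Some q0 then wins T A q0 /\ W q0 q else q = p.
apply: (@wins_memory _ _ _ upd R None) => //.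
- case=> [q0|] q _ /=.
    move=> [w Wq] Tq; have [[cl _] _] := WP _ w.
    by apply: E_mono (cl _ Wq Tq) => t Wt Tt; split=> //; apply: Wt.
  by move=> -> _; apply: E_mono H => t Wt Tt; split; [apply: Wt | apply WP, Wt].
- move=> x m _ m0 mS Hx; have m1 n : size p < n -> m n = Some (hist x (size p).+1).
    elim: n => // n IH; rewrite ltnS leq_eqVlt => /orP[/eqP e|lt].
      by rewrite -e mS // m0.
    by rewrite mS ?(ltnW lt) // IH.
  have [w _] : R (Some (hist x (size p).+1)) (hist x (size p).+1).
    by rewrite -(m1 (size p).+1) //; apply: (Hx _ _).1.
  have [[_ pl] _] := WP _ w; apply: (pl x (size p).+1) => n lt.
  by have [] := Hx n (ltnW lt); rewrite m1 // => -[].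
Qed.

(** * One stage of Davis' proof: avoiding a single Pi^0_2 set *)

Section OneStage.
Variables (T : seq X -> Prop) (A : (nat -> X) -> Prop).
Variable d : nat -> seq X -> Prop.
Hypothesis d_up : forall n t q, d n q -> d n (t :: q).
Hypothesis d_down : forall m n q, m <= n -> d n q -> d m q.

(** Having a prefix in [d n] is an open condition, so this is a Pi^0_2 set of plays. *)
Definition all_hit x := forall n, exists k, d n (hist x k).

(* The opponent can shrink [T] so as to avoid [all_hit] without becoming lost. *)
Definition good p := exists T' : seq X -> Prop,
  [/\ forall q, T' q -> T q, T' p,
      forall x n0, (forall n, n0 <= n -> T' (hist x n)) -> ~ all_hit x
    & ~ wins T' A p].

(** The index [size p] grows from one bad history to the next, so an endless chain of them hits
    every [d n]. *)
Definition reach_bad (p : seq X) x := A x \/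
  exists k, [/\ size p < k, d (size p) (hist x k) & ~ good (hist x k)].

Lemma d_up_hist n x k l : k <= l -> d n (hist x k) -> d n (hist x l).
Proof.
move=> le; rewrite -(subnKC le); elim: (l - k) => [|i IH]; rewrite ?addn0 // addnS.
by move=> /IH; apply: d_up.
Qed.

(** Contrapositive: if the first player does not win [reach_bad p], the opponent stays among
    histories with this property until [d (size p)] is first hit. The history reached is then good,
    and the opponent changes to the constraint that its goodness provides. *)
Lemma not_good_wins p : T p -> ~ good p -> wins T (reach_bad p) p.
Proof.
move=> Tp ngp; apply: NNPP => nwin; apply: ngp.
have [G GP] : exists G : seq X -> seq X -> Prop, forall q, good q ->
    [/\ forall r, G q r -> T r, G q q,
      forall x n0, (forall n, n0 <= n -> G q (hist x n)) -> ~ all_hit x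
    & ~ wins (G q) A q].
  apply: (fun_choice (fun q (T' : seq X -> Prop) => good q ->
    [/\ forall r, T' r -> T r, T' q,
      forall x n0, (forall n, n0 <= n -> T' (hist x n)) -> ~ all_hit x
    & ~ wins T' A q])) => q.
  by case: (classic (good q)) => [[T' H]|ng]; [exists T' | exists T].
have dW q : size p < size q -> d (size p) q -> ~ wins T (reach_bad p) q -> good q.
  move=> lt dq nw; apply: NNPP => ng; apply: nw; apply: wins_all => x e.
  by right; exists (size q); rewrite e.
(* [mark q] is the first history beyond the length of [p], on the way to [q], that lies in
   [d (size p)]. *)
pose mark := fix mark q : option (seq X) := if size q <= size p then None else
  if q is t :: q' then
    if mark q' is Some q0 then Some q0
    else if excluded_middle_informative (d (size p) q) then Some q else None
  else None.
have markS t q : size p <= size q -> mark (t :: q) =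
    if mark q is Some q0 then Some q0
    else if excluded_middle_informative (d (size p) (t :: q)) then Some (t :: q)
    else None.
  by move=> le /=; rewrite ltnNge le.
have mark0 q : size q <= size p -> mark q = None.
  by case: q => [|t q] //=; move=> ->.
have markp : mark p = None by apply: mark0.
pose U q := T q /\ ~ wins T (reach_bad p) q.
pose T' q := size p <= size q /\
  if mark q is Some q0 then good q0 /\ G q0 q else U q.
have T'sub q : T' q -> T q.
  by case=> _; case: (mark q) => [q0 [/GP[sub _ _ _]]|[]] // /sub.
have T'U t q : size p <= size q -> mark q = None -> U (t :: q) -> T' (t :: q).
  move=> le mN [Tt nw]; split; first exact: leqW.
  rewrite markS // mN; case: excluded_middle_informative => // dt.
  have gt : good (t :: q) by apply: dW.
  by split=> //; case: (GP _ gt).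
exists T'; split=> //; first by split; rewrite // markp.
- move=> x n0 HT' hit.
  (* Either the play gets marked and stays in some [G q0], which avoids [all_hit], or it never meets
     [d (size p)]. *)
  case: (classic (exists n q0, [/\ n0 <= n, size p <= n & mark (hist x n) = Some q0])).
    move=> [n [q0 [len lep mk]]].
    have mk' k : mark (hist x (n + k)) = Some q0.
      elim: k => [|k IH]; rewrite ?addn0 // addnS markS ?IH // size_hist.
      exact: leq_trans lep (leq_addr _ _).
    have H k : good q0 /\ G q0 (hist x (n + k)).
      have [_] := HT' (n + k) (leq_trans len (leq_addr _ _)); by rewrite mk'.
    have [_ _ av _] := GP _ (H 0).1; apply: (av x n) hit => k le.
    by rewrite -(subnKC le); apply: (H _).2.
  move=> nmk; have [k dk] := hit (size p).
  pose n := maxn k (maxn n0 (size p)).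
  have lekn : k <= n := leq_maxl _ _.
  have len0 : n0 <= n := leq_trans (leq_maxl _ _) (leq_maxr _ _).
  have lep : size p <= n := leq_trans (leq_maxr _ _) (leq_maxr _ _).
  apply: nmk; exists n.+1; case e: (mark (hist x n.+1)) => [q0|].
    by exists q0; split=> //; apply: leqW.
  move: e; rewrite markS ?size_hist //; case: (mark _) => // .
  by case: excluded_middle_informative => // -[];
    apply: (@d_up_hist _ x k n.+1) dk; apply: leqW.
- move=> [S [[Scl Spl] Sp]]; apply: (nwin).
  (* A strategy for [A] inside [T'] cannot reach a newly marked [q]: on the histories marked by [q],
     the constraint is [G q], under which [A] is not won. *)
  have noswitch q : S q -> T' q -> size p < size q -> mark q = Some q -> False.
    move=> Sq [_] + lt mq; rewrite mq => -[gq _]; have [_ Gqq _ nw] := GP _ gq.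
    apply: nw; exists (fun r => [/\ S r, size p < size r & mark r = Some q]).
    split=> //; split=> [r [Sr ltr mr] Gr|x n0 H].
      have T'r : T' r by split; [apply: ltnW | rewrite mr].
      apply: E_mono (Scl r Sr T'r) => t St Gt.
      have mt : mark (t :: r) = Some q by rewrite markS ?mr // ltnW.
      have ltt : size p < size (t :: r) by apply: ltnW.
      by split=> //; apply: St; split; [apply: ltnW | rewrite mt].
    apply: (Spl x n0) => n /H[[Sn ltn mn] Gn]; split=> //.
    by split; [apply: ltnW | rewrite mn].
  have [W WP] := wins_choice T (reach_bad p).
  (* [None] means that [S] is followed inside [U]. Once [U] is left, [reach_bad p] is won, and the
     memory keeps the history whose winning strategy takes over. *)
  pose upd (m : option (seq X)) q := if m is Some q0 then Some q0
    else if excluded_middle_informative (U q) then None else Some q.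
  pose R m q := if m is Some q0 then wins T (reach_bad p) q0 /\ W q0 q
    else [/\ S q, mark q = None & U q].
  apply: (@wins_memory _ _ _ upd R None); first by split.
  + case=> [q0|] q le /=.
      move=> [w Wq] Tq; have [[cl _] _] := WP _ w.
      by apply: E_mono (cl _ Wq Tq) => t Wt Tt; split=> //; apply: Wt.
    move=> [Sq mq Uq] Tq; have T'q : T' q by split; rewrite ?mq.
    apply: E_mono (Scl _ Sq T'q) => t St Tt.
    case: excluded_middle_informative => [Ut|nUt] /=.
      have T't : T' (t :: q) by apply: T'U.
      split=> //; first exact: St.
      case e: (mark (t :: q)) => [q0|] //; exfalso.
      move: (e); rewrite markS // mq; case: excluded_middle_informative => // dt.
      by case=> e'; apply: (noswitch (t :: q)) => //; [apply: St | rewrite e e'].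
    have w : wins T (reach_bad p) (t :: q) by apply: NNPP => nw; apply: nUt.
    by split=> //; apply WP.
  + move=> x m _ m0 mS Hx.
    case: (classic (exists n q0, size p <= n /\ m n = Some q0)).
      move=> [n [q0 [len mn]]].
      have mk k : m (n + k) = Some q0.
        elim: k => [|k IH]; rewrite ?addn0 // addnS mS ?IH //.
        exact: leq_trans len (leq_addr _ _).
      have [w _] : R (Some q0) (hist x n) by rewrite -mn; apply: (Hx _ _).1.
      have [[_ pl] _] := WP _ w; apply: (pl x n) => k le.
      have [] := Hx k (leq_trans len le).
      by rewrite -(subnKC le) mk => -[].
    move=> nmk; left; apply: (Spl x (size p)) => n le.
    have [Rn Tn] := Hx n le; case e: (m n) Rn => [q0|] /=.
      by case: nmk; exists n, q0.
    by move=> [Sn mn Un]; split=> //; split; rewrite ?size_hist ?mn.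
Qed.

(* A bad history is turned into a win of the first player by running the
   strategies of [not_good_wins] one after the other: if the switches never
   stop, the play is in the set [all_hit], which is part of [A]. *)
Lemma not_wins_good p :
  (forall x, all_hit x -> A x) -> T p -> ~ wins T A p -> good p.
Proof.
move=> BA Tp nw; apply: NNPP => ngp; apply: nw.
have [V VP] : exists V : seq X -> seq X -> Prop, forall q, T q -> ~ good q ->
    strategy T (reach_bad q) (V q) /\ V q q.
  apply: (fun_choice (fun q S => T q -> ~ good q ->
    strategy T (reach_bad q) S /\ S q)) => q.
  case: (classic (T q /\ ~ good q)) => [[Tq ng]|n].
    by have [S HS] := not_good_wins Tq ng; exists S.
  by exists T => Tq ng; case: n.
(* The memory is the bad history whose strategy is being followed; it is replaced when a bad history
   in [d (size q0)] turns up. *)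
pose upd (q0 q : seq X) :=
  if excluded_middle_informative (d (size q0) q /\ ~ good q) then q else q0.
pose R q0 q := [/\ T q0, ~ good q0 & V q0 q].
apply: (@wins_memory _ _ _ upd R p).
- by split=> //; apply VP.
- move=> q0 q _ [T0 ng0 Vq] Tq; have [[cl _] _] := VP _ T0 ng0.
  apply: E_mono (cl _ Vq Tq) => t Vt Tt; rewrite /upd.
  case: excluded_middle_informative => [[dt ngt]|nd] /=.
    by split=> //; apply VP.
  by split=> //; apply: Vt.
- move=> x m _ m0 mS Hx; apply: NNPP => nA.
  (* No occasion to switch has been missed since the current strategy was taken up. *)
  have inv n : size p <= n -> size (m n) <= n /\
      forall k, size (m n) < k <= n -> ~ (d (size (m n)) (hist x k) /\ ~ good (hist x k)).
    elim: n => [|n IH] le.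
      have e : size p = 0 by apply/eqP; rewrite -leqn0.
      rewrite -[in m 0]e m0 e; split=> // k /andP[lt].
      by rewrite leqn0 => /eqP e0; rewrite e0 in lt.
    move: le; rewrite leq_eqVlt => /orP[/eqP e|lt].
      rewrite -e m0; split=> // k /andP[lt le]; by rewrite ltnNge le in lt.
    have [le H] := IH lt; rewrite mS // /upd.
    case: excluded_middle_informative => [dn|nd] /=.
      by rewrite size_hist; split=> // k /andP[lt' le']; rewrite ltnNge le' in lt'.
    split; first exact: leqW.
    move=> k /andP[ltk]; rewrite leq_eqVlt => /orP[/eqP -> //|lek].
    by apply: H; rewrite ltk.
  (* Without a further switch one strategy would be followed forever. As [A] fails, the play meets
     its bad target, an occasion missed against [inv]. *)
  have sw n : size p <= n -> exists k, [/\ n < k, size (m k) = k & d (size (m n)) (hist x k)].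
    move=> le; apply: NNPP => nsw.
    have mk k : m (n + k) = m n.
      elim: k => [|k IH]; rewrite ?addn0 // addnS mS ?(leq_trans le (leq_addr _ _)) //.
      rewrite /upd IH; case: excluded_middle_informative => // -[dk ng]; case: nsw.
      exists (n + k).+1; rewrite ltnS leq_addr; split=> //.
      rewrite mS ?(leq_trans le (leq_addr _ _)) // /upd IH.
      by case: excluded_middle_informative => [?|[]] //=; rewrite size_hist.
    have [Rn _] := Hx n le; case: (Rn) => T0 ng0 _.
    have [[_ pl] _] := VP _ T0 ng0.
    have [//|[k [ltk dk ngk]]] : reach_bad (m n) x.
      apply: (pl x n) => l lel; have [] := Hx l (leq_trans le lel).
      by rewrite -(subnKC lel) mk => -[].
    have [_] := inv (n + k) (leq_trans le (leq_addr _ _)).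
    by move/(_ k); rewrite mk ltk leq_addl; apply.
  have sw' i : exists k, [/\ size p <= k, i <= k & size (m k) = k].
    elim: i => [|i [k [lep lei _]]].
      have [k [lt e _]] := sw (size p) (leqnn _).
      by exists k; split=> //; apply: ltnW.
    have [k' [lt e _]] := sw k lep; exists k'; split=> //.
      exact: leq_trans lep (ltnW lt).
    exact: leq_ltn_trans lei lt.
  apply: nA; apply: BA => n.
  have [k [lep lei e]] := sw' n; have [k' [_ _ dk]] := sw k lep.
  by exists k'; apply: d_down dk; rewrite e.
Qed.

End OneStage.

(** Unless the first player wins at the root, the opponent plays in stages: stage [i] shrinks the
    constraint so as to avoid [all_hit (d i)], while keeping the first player from winning [A]. *)
Theorem sigma3_determinacy A (d : nat -> nat -> seq X -> Prop) :
  (forall i n t q, d i n q -> d i n (t :: q)) ->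
  (forall i m n q, m <= n -> d i n q -> d i m q) ->
  (forall x, A x <-> exists i, all_hit (d i) x) ->
  (exists S, [/\ S [::], forall q, S q -> E q (fun t => S (t :: q))
     & forall x, (forall n, S (hist x n)) -> A x]) \/
  (exists S, [/\ S [::], forall q, S q -> ~ E q (fun t => ~ S (t :: q))
     & forall x, (forall n, S (hist x n)) -> ~ A x]).
Proof.
move=> d_up d_down AP.
case: (classic (wins (fun=> True) A [::])) => [[S [[cl pl] S0]]|nw].
  left; exists S; split=> // [q Sq|x HS].
    by apply: E_mono (cl q Sq I) => t; apply.
  by apply: (pl x 0) => n _.
right.
(* The inclusion is demanded at every history, so that [tr] decreases along all plays. *)
pose pickP T i q (T' : seq X -> Prop) := (forall r, T' r -> T r) /\
  (good T A (d i) q -> [/\ T' q, ~ wins T' A q &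
     forall x n0, (forall n, n0 <= n -> T' (hist x n)) -> ~ all_hit (d i) x]).
have [pick pickE] : exists pick : (seq X -> Prop) -> nat -> seq X -> seq X -> Prop,
    forall T i q, pickP T i q (pick T i q).
  have [pick H] : exists pick : (seq X -> Prop) * nat * seq X -> seq X -> Prop,
      forall u, pickP u.1.1 u.1.2 u.2 (pick u).
    apply: (fun_choice (fun u T' => pickP u.1.1 u.1.2 u.2 T')) => -[[T i] q] /=.
    case: (classic (good T A (d i) q)) => [[T' [sub T'q av nw']]|ng].
      by exists T'.
    by exists T.
  by exists (fun T i q => pick (T, i, q)) => T i q; apply: (H (T, i, q)).
pose tr := fix tr q := if q is t :: q' then pick (tr q') (size q') q else fun=> True.
have trS t q : tr (t :: q) = pick (tr q) (size q) (t :: q) by [].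
pose S q := [/\ tr q q, ~ wins (tr q) A q & forall i, i < size q ->
  forall x n0, (forall n, n0 <= n -> tr q (hist x n)) -> ~ all_hit (d i) x].
exists S; split=> [|q [Tq nwq av]|x HS Ax]; first by split.
  (* If the first player could force the play out of [S], every successor allowed by [tr q] would be
     winning: one that is not is good for stage [size q], and [pick] puts it into [S]. *)
  move=> H; apply: nwq; apply: wins_step; apply: E_mono H => t nS Tt.
  apply: NNPP => nwt; apply: nS.
  have gt : good (tr q) A (d (size q)) (t :: q).
    apply: not_wins_good (Tt) nwt => [n r u|m n r|x hx].
    - exact: d_up.
    - exact: d_down.
    - by apply/AP; exists (size q).
  have [sub /(_ gt)[Tt' nwt' av']] := pickE (tr q) (size q) (t :: q).
  split=> // i; rewrite /= ltnS leq_eqVlt => /orP[/eqP -> //|lt] x n0 Hx.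
  by apply: (av i lt x n0) => n /Hx /sub.
(* As [tr] decreases, the play after stage [i] lies in [tr (hist x i.+1)], which avoids
   [all_hit (d i)]. *)
have [i hit] := (AP x).1 Ax.
have [_ _ /(_ i)] := HS i.+1; rewrite size_hist leqnn => /(_ isT x i.+1).
apply=> // n le; have [] := HS n; rewrite -(subnKC le).
elim: (n - i.+1) => [|k IH]; rewrite ?addn0 // addnS => Tk _ _.
suff sub k' r : tr (hist x (i.+1 + k')) r -> tr (hist x i.+1) r.
  by apply: (sub k.+1); rewrite addnS.
elim: k' r {IH Tk} => [|k' IH'] r; rewrite ?addn0 // addnS [hist x _.+1]/= trS.
by move=> /(pickE _ _ _).1 /IH'.
Qed.

End Determinacy.

(** * LTL properties *)

Definition truth (P : Prop) : bool :=
  if excluded_middle_informative P then true else false.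

Lemma truthP (P : Prop) : reflect P (truth P).
Proof. by rewrite /truth; case: excluded_middle_informative => H; constructor. Qed.

Section Prophetic.
Variable X : Type.
Implicit Types (w : nat -> X) (P Q : (nat -> X) -> nat -> Prop).

Definition next_p P w i := P w i.+1.

Definition until_p P Q w i :=
  exists k, Q w (i + k) /\ forall j, j < k -> P w (i + j).

Definition release_p P Q w i :=
  forall k, Q w (i + k) \/ exists j, j < k /\ P w (i + j).

Lemma until_pE P Q w i :
  until_p P Q w i <-> Q w i \/ P w i /\ until_p P Q w i.+1.
Proof.
split=> [[[|k] [Qk Pk]]|[Qi|[Pi [k [Qk Pk]]]]].
- by left; rewrite addn0 in Qk.
- right; split; first by rewrite -[i]addn0; apply: Pk.
  exists k; rewrite addSnnS; split=> // j lt; rewrite addSnnS; exact: Pk.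
- by exists 0; rewrite addn0.
- exists k.+1; rewrite -addSnnS; split=> // -[|j] lt; first by rewrite addn0.
  by rewrite -addSnnS; apply: Pk.
Qed.

(* Every word carries exactly one fair run of the automaton, and the state
   reached at position [i] tells whether [P w i] holds. *)
Inductive prophetic P : Prop := Prophetic (V F : finType)
  (step : X -> V -> V) (acc : F -> pred V) (out : pred V)
  (run : (nat -> X) -> nat -> V) of
  (forall w i, run w i = step (w i) (run w i.+1)) &
  (forall w f n, exists2 i, n <= i & acc f (run w i)) &
  (forall w (l : nat -> V), (forall i, l i = step (w i) (l i.+1)) ->
     (forall f n, exists2 i, n <= i & acc f (l i)) -> l =1 run w) &
  (forall w i, P w i <-> out (run w i)).

Lemma prophetic_ext P Q :
  (forall w i, P w i <-> Q w i) -> prophetic P -> prophetic Q.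
Proof.
move=> PQ [V F step acc out run r1 r2 r3 r4].
by exists V F step acc out run => // w i; rewrite -PQ.
Qed.

Lemma prophetic_state (p : X -> Prop) : prophetic (fun w i => p (w i)).
Proof.
exists bool void (fun t _ => truth (p t)) (fun _ _ => true) (fun b => b)
  (fun w i => truth (p (w i))) => // w i.
by split=> /truthP.
Qed.

(** Uniqueness of the fair run reduces complementation to negating the output. *)
Lemma prophetic_not P : prophetic P -> prophetic (fun w i => ~ P w i).
Proof.
move=> [V F step acc out run r1 r2 r3 r4].
exists V F step acc (fun v => ~~ out v) run => // w i.
by rewrite r4; split=> /negP.
Qed.

Lemma prophetic_and P Q :
  prophetic P -> prophetic Q -> prophetic (fun w i => P w i /\ Q w i).
Proof.
move=> [V F step acc out run r1 r2 r3 r4] [V' F' step' acc' out' run' r1' r2' r3' r4'].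
exists (V * V')%type (F + F')%type
  (fun t v => (step t v.1, step' t v.2))
  (fun f v => match f with inl f => acc f v.1 | inr f => acc' f v.2 end)
  (fun v => out v.1 && out' v.2)
  (fun w i => (run w i, run' w i)) => [w i|w [] f n|w l lS lf i|w i] /=.
- by rewrite -r1 -r1'.
- exact: r2.
- exact: r2'.
- rewrite -(r3 w (fun i => (l i).1)) => [|j|f n].
  + rewrite -(r3' w (fun i => (l i).2)) => [|j|f n]; first exact: surjective_pairing.
    * by rewrite lS.
    * exact: lf (inr f) n.
  + by rewrite lS.
  + exact: lf (inl f) n.
- by rewrite r4 r4'; split=> /andP.
Qed.

Lemma prophetic_or P Q :
  prophetic P -> prophetic Q -> prophetic (fun w i => P w i \/ Q w i).
Proof.
move=> /prophetic_not nP /prophetic_not nQ.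
apply: prophetic_ext (prophetic_not (prophetic_and nP nQ)) => w i.
by split=> [H|H [nPi nQi]]; [apply: NNPP | case: H] => //; tauto.
Qed.

Lemma prophetic_next P : prophetic P -> prophetic (next_p P).
Proof.
move=> [V F step acc out run r1 r2 r3 r4].
exists (V * bool)%type F (fun t v => (step t v.1, out v.1)) (fun f v => acc f v.1)
  (fun v => v.2) (fun w i => (run w i, out (run w i.+1))) => [w i|||w i] //=.
- by rewrite -r1.
- move=> w l lS lf i.
  have E : (fun i => (l i).1) =1 run w.
    by apply: r3 => [j|f n]; [rewrite lS | apply: lf].
  by rewrite -!E; have := lS i; case: (l i) => a b [_ ->].
- exact: r4.
Qed.

(** The extra bit follows the expansion law [until_pE] backwards. That law also admits a bit that
    stays true although [Q] never occurs; the added acceptance condition excludes it. *)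
Lemma prophetic_until P Q :
  prophetic P -> prophetic Q -> prophetic (until_p P Q).
Proof.
move=> [V F step acc out run r1 r2 r3 r4] [V' F' step' acc' out' run' r1' r2' r3' r4'].
pose U w i := truth (until_p P Q w i).
have UE w i : U w i = out' (run' w i) || out (run w i) && U w i.+1.
  apply/truthP/idP => [/until_pE[/r4' -> //|[/r4 -> /truthP Ui]]|].
    by rewrite [U w i.+1]Ui orbT.
  case/orP=> [/r4' Qi|/andP[/r4 Pi /truthP Ui]]; apply/until_pE; first by left.
  by right.
exists (V * V' * bool)%type (F + F' + unit)%type
  (fun t v => let u := step t v.1.1 in let u' := step' t v.1.2 in
     (u, u', out' u' || out u && v.2))
  (fun f v => match f with inl (inl f) => acc f v.1.1 | inl (inr f) => acc' f v.1.2
     | inr _ => v.2 ==> out' v.1.2 end)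
  (fun v => v.2)
  (fun w i => (run w i, run' w i, U w i)) => [w i|w [[]f|[]] n|w l lS lf i|w i] /=.
- by rewrite -r1 -r1' -UE.
- exact: r2.
- exact: r2'.
- case e: (U w n); last by exists n; rewrite // e.
  have /truthP[k [/r4' Qk _]] := e.
  by exists (n + k); [apply: leq_addr | rewrite Qk implybT].
- have E j : (l j).1.1 = run w j.
    by apply: (r3 w (fun i => (l i).1.1)) => [m|f n];
      [rewrite lS | apply: (lf (inl (inl f)))].
  have E' j : (l j).1.2 = run' w j.
    by apply: (r3' w (fun i => (l i).1.2)) => [m|f n];
      [rewrite lS | apply: (lf (inl (inr f)))].
  have EU j : (l j).2 = out' (run' w j) || out (run w j) && (l j.+1).2.
    by rewrite -E -E' lS.
  suff: (l i).2 = U w i by rewrite -E -E' => <-; case: (l i) => -[].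
  apply/idP/truthP => [li|[k [/r4' Qk Pk]]].
    (* The bit is traced from [i] to a position where the new condition holds: there [Q] occurs,
       unless it has occurred before. *)
    have [j le /implyP H] := lf (inr tt) i.
    rewrite -(subnKC le) in H; move: H; move: (j - i) {le} => m; elim: m i li => [|m IH] i li.
      by rewrite addn0 => /(_ li); rewrite E' => /r4' Qi; apply/until_pE; left.
    move: (li); rewrite EU => /orP[/r4' Qi _|/andP[/r4 Pi li']].
      by apply/until_pE; left.
    by rewrite -addSnnS => /(IH _ li') Ui; apply/until_pE; right.
  elim: k i Qk Pk => [|k IH] i Qk Pk; rewrite EU.
    by rewrite addn0 in Qk; rewrite Qk.
  have := Pk 0 isT; rewrite addn0 => /r4 ->; rewrite IH ?orbT // => [|j lt].
    by rewrite addSnnS.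
  by rewrite addSnnS; apply: Pk.
- by split=> /truthP.
Qed.

Lemma prophetic_release P Q :
  prophetic P -> prophetic Q -> prophetic (release_p P Q).
Proof.
move=> /prophetic_not nP /prophetic_not nQ.
apply: prophetic_ext (prophetic_not (prophetic_until nP nQ)) => w i.
split=> [H k|H [k [nQk nPk]]].
  apply: NNPP => /not_or_and[nQk nP']; apply: H; exists k; split=> // j lt Pj.
  by apply: nP'; exists j.
by case: (H k) => // -[j [/nPk]].
Qed.

End Prophetic.

(** * Prophetic properties are Sigma^0_3 *)

Section Sigma3.
Variables (X : Type) (P : (nat -> X) -> nat -> Prop).
Implicit Types w : nat -> X.

Lemma infinite_fiber (C : finType) (f : nat -> C) (Q : nat -> Prop) :
  (forall n, exists2 i, n <= i & Q i) ->
  exists c, forall n, exists2 i, n <= i & Q i /\ f i = c.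
Proof.
move=> inf; apply: NNPP => H.
have [b bP] : exists b : C -> nat, forall c i, b c <= i -> Q i -> f i <> c.
  apply: (@fin_all_exists C (fun=> nat)
    (fun c n => forall i, n <= i -> Q i -> f i <> c)) => c.
  apply: NNPP => nb; apply: H; exists c => n.
  apply: NNPP => ni; apply: nb; exists n => i le Qi fi; apply: ni; by exists i.
have [i le Qi] := inf (\max_c b c).
by apply: (bP (f i) i _ Qi erefl); apply: leq_trans le; apply: leq_bigmax.
Qed.

(* Shelah's merging argument: two positions are merged when they get the same
   colour at some later time; there are at most [#|C|] unmerged positions. *)
Lemma infinitely_merged (C : finType) (col : nat -> nat -> C) :
  exists k, forall n, exists2 j, n <= j &
    exists m, [/\ k <= m, j <= m & col k m = col j m].
Proof.
apply: NNPP => H.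
have [b bP] : exists b : nat -> nat, forall k j, b k <= j -> forall m,
    k <= m -> j <= m -> col k m <> col j m.
  apply: (fun_choice (fun k n => forall j, n <= j -> forall m,
    k <= m -> j <= m -> col k m <> col j m)) => k.
  apply: NNPP => nb; apply: H; exists k => n; apply: NNPP => ni; apply: nb.
  exists n => j le m km jm e; apply: ni; exists j => //; by exists m.
(* [M n.+1] lies beyond the bound for [M n], so these positions never merge with each other;
   [#|C|.+1] of them would need as many colours at one time. *)
pose M := fix M n := if n is n'.+1 then maxn (M n') (b (M n')) else 0.
have Mmono i j : i <= j -> M i <= M j.
  move=> le; rewrite -(subnKC le); elim: (j - i) => [|k IH]; rewrite ?addn0 // addnS.
  exact: leq_trans IH (leq_maxl _ _).
have Msep i j n : i < j -> j <= n -> col (M i) (M n) <> col (M j) (M n).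
  move=> lt le; apply: bP; last exact: Mmono.
  - by apply: leq_trans (Mmono _ _ lt); apply: leq_maxr.
  - by apply: Mmono; apply: leq_trans le; apply: ltnW.
have := @leq_card 'I_#|C|.+1 C (fun i => col (M i) (M #|C|)).
rewrite card_ord ltnn => F; suff: false by []; apply: F => i j e.
apply/val_inj/eqP; case: ltngtP => // lt.
- by case: (Msep i j #|C| lt); rewrite -1?ltnS.
- by case: (Msep j i #|C| lt); rewrite -1?ltnS.
Qed.

Section Blocks.
Variables (V F : finType) (step : X -> V -> V) (acc : F -> pred V).

(* Maps the state after the block [w i .. w (i + l - 1)] to the state before it
   and to the acceptance conditions met inside. *)
Fixpoint block w i l : {ffun V -> V * {ffun F -> bool}} :=
  if l is l'.+1 then
    [ffun v => let r := block w i.+1 l' v in let u := step (w i) r.1 in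
       (u, [ffun f => acc f u || r.2 f])]
  else [ffun v => (v, [ffun=> false])].

Definition seg w i j := block w i (j - i).

Lemma block_cat w i l1 l2 v :
  block w i (l1 + l2) v =
  let r2 := block w (i + l1) l2 v in let r1 := block w i l1 r2.1 in
  (r1.1, [ffun f => r1.2 f || r2.2 f]).
Proof.
elim: l1 i => [|l1 IH] i /=.
  rewrite addn0 ffunE /=; case: (block w i l2 v) => u h /=; congr pair.
  by apply/ffunP => f; rewrite !ffunE.
rewrite !ffunE IH addSnnS /=; congr pair.
by apply/ffunP => f; rewrite !ffunE orbA.
Qed.

Lemma seg_cat w i j k v : i <= j -> j <= k ->
  seg w i k v = let r2 := seg w j k v in let r1 := seg w i j r2.1 in
  (r1.1, [ffun f => r1.2 f || r2.2 f]).
Proof.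
move=> ij jk; rewrite /seg; have -> : k - i = (j - i) + (k - j).
  by rewrite addnC addnBA // subnK.
by rewrite block_cat subnKC.
Qed.

(** Merging is permanent, since both blocks are continued by the same letters. *)
Lemma seg_merge w i i' m j : i <= m -> i' <= m -> m <= j ->
  seg w i m = seg w i' m -> seg w i j = seg w i' j.
Proof.
move=> im i'm mj e; apply/ffunP => v.
by rewrite (seg_cat _ _ im mj) (seg_cat _ _ i'm mj) e.
Qed.

Lemma seg_ext w w' i j :
  (forall n, n < j -> w n = w' n) -> seg w i j = seg w' i j.
Proof.
rewrite /seg => E; case: (leqP i j) => [ij|/ltnW ji]; last first.
  by have /eqP -> : j - i == 0 by rewrite subn_eq0.
have : i + (j - i) <= j by rewrite subnKC.
move: (j - i) {ij} => l; elim: l i => [|l IH] i //= le; rewrite E ?IH //.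
  by rewrite addSnnS.
by apply: leq_trans le; rewrite addnS ltnS leq_addr.
Qed.

Lemma seg_step w i j v : i < j ->
  (seg w i j v).1 = step (w i) (seg w i.+1 j v).1.
Proof. by move=> lt; rewrite /seg -subnSK //= ffunE. Qed.

Lemma seg_acc w i j v f : i <= j -> (seg w i j v).2 f ->
  exists n, [/\ i <= n, n < j & acc f (seg w n j v).1].
Proof.
rewrite /seg => ij; rewrite -{2 3}(subnKC ij).
move: (j - i) {ij} => l; elim: l i => [|l IH] i /=.
  by rewrite !ffunE.
rewrite !ffunE /= => /orP[a|/IH[n [le lt a]]].
  exists i; rewrite leqnn addnS ltnS leq_addr; split=> //.
  by rewrite -addnS addKn /= ffunE.
by exists n; rewrite -addSnnS; split=> //; apply: ltnW.
Qed.

Section Run.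
Variables (w : nat -> X) (l : nat -> V).
Hypothesis lS : forall i, l i = step (w i) (l i.+1).

Lemma seg_run i j : i <= j -> (seg w i j (l j)).1 = l i.
Proof.
rewrite /seg => ij; rewrite -{2}(subnKC ij).
move: (j - i) {ij} => n; elim: n i => [|n IH] i /=.
  by rewrite addn0 ffunE.
by rewrite ffunE /= -addSnnS IH -lS.
Qed.

Lemma seg_run_acc i n j f : i <= n -> n < j -> acc f (l n) ->
  (seg w i j (l j)).2 f.
Proof.
move=> le lt a; have ij := leq_trans le (ltnW lt).
rewrite (seg_cat _ _ le (ltnW lt)) /= ffunE.
have -> : (seg w n j (l j)).2 f; last exact: orbT.
rewrite /seg -subnSK //= ffunE /= ffunE.
by have := seg_run lt; rewrite /seg => ->; rewrite -lS a.
Qed.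

End Run.

(** [m] is a time by which [k] and [j] have merged. A finite prefix of [w] decides this, which makes
    it an open condition. *)
Definition merging w k e n := exists j m,
  [/\ n <= j, k <= j, j <= m, seg w k j = e & seg w k m = seg w j m].

Definition fair_loop (e : {ffun V -> V * {ffun F -> bool}}) v :=
  (e v).1 = v /\ forall f, (e v).2 f.

(** The word after [k] is cut into blocks that all equal [e], and [v] is pulled back from the cuts.
    As [e] fixes [v], the choice of the cut does not matter; as each block meets every acceptance
    condition, the run is fair. *)
Lemma merging_run w k e v : fair_loop e v -> (forall n, merging w k e n) ->
  exists l : nat -> V, [/\ forall i, l i = step (w i) (l i.+1),
    forall f n, exists2 i, n <= i & acc f (l i) & l 0 = (seg w 0 k v).1].
Proof.
move=> [ev ef] mer.
pose J j := k <= j /\ exists2 m, j <= m & seg w k m = seg w j m.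
have [nxt nxtP] : exists nxt : nat -> nat, forall j, J j ->
    [/\ J (nxt j), j < nxt j & seg w j (nxt j) = e].
  apply: (fun_choice (fun j j' => J j ->
    [/\ J j', j < j' & seg w j j' = e])) => j.
  case: (classic (J j)) => [[kj [m jm km]]|nJ]; last by exists 0.
  (* The next cut lies beyond the time [m] at which [k] and [j] merge, so the block from [j] equals
     the one from [k], which is [e]. *)
  have [j' [m' [lej' kj' jm' ej' km']]] := mer (maxn m j.+1).
  move: lej'; rewrite geq_max => /andP[mj' jj'].
  exists j' => _; split=> //; first by split=> //; exists m'.
  by rewrite -ej'; symmetry; apply: seg_merge mj' km => //; apply: leq_trans jm.
pose cut n := iter n nxt k.
have Jk : J k by split=> //; exists k.
have Jcut n : J (cut n) by elim: n => //= n /nxtP[].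
have cutS n : cut n < cut n.+1 by have [] := nxtP _ (Jcut n).
have cute n : seg w (cut n) (cut n.+1) = e by have [] := nxtP _ (Jcut n).
have cut_ge n : n <= cut n by elim: n => // n IH; apply: leq_ltn_trans IH (cutS n).
have cut_mono a d : cut a <= cut (a + d).
  by elim: d => [|d IH]; rewrite ?addn0 // addnS; apply: leq_trans IH (ltnW (cutS _)).
have stable n a b : n <= cut a -> a <= b ->
    (seg w n (cut b) v).1 = (seg w n (cut a) v).1.
  move=> le ab; rewrite -(subnKC ab); elim: (b - a) => [|d IH]; rewrite ?addn0 // addnS.
  by rewrite (seg_cat _ _ (leq_trans le (cut_mono a d)) (ltnW (cutS _))) /= cute ev.
have stable' n a b : n <= cut a -> n <= cut b ->
    (seg w n (cut b) v).1 = (seg w n (cut a) v).1.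
  by move=> na nb; case: (leqP a b) => [|/ltnW] ab; [|symmetry]; apply: stable.
exists (fun n => (seg w n (cut n) v).1); split=> [i|f n|].
- by rewrite -seg_step ?cut_ge //; apply: stable' (cut_ge i); apply/ltnW/cut_ge.
- have [|i [le lt a]] := @seg_acc w (cut n) (cut n.+1) v f (ltnW (cutS n)).
    by rewrite cute.
  exists i; first exact: leq_trans (cut_ge n) le.
  by rewrite (@stable' _ n.+1) // ltnW.
- by [].
Qed.

End Blocks.

Definition cons_word s (x : nat -> X) n := if n is m.+1 then x m else s.

(** Histories omit the initial state [s], which is put back here. Positions beyond [size q] get the
    default [s] and carry no information. *)
Definition hist_word s q n : X := nth s (s :: rev q) n.

Lemma hist_word_cons s t q n : n <= size q -> hist_word s (t :: q) n = hist_word s q n.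
Proof.
case: n => // n lt; rewrite /hist_word /= rev_cons nth_rcons size_rev.
by rewrite lt.
Qed.

Lemma hist_wordE s x k n : n <= k -> hist_word s (hist x k) n = cons_word s x n.
Proof.
elim: k => [|k IH]; first by case: n.
rewrite leq_eqVlt => /orP[/eqP ->|lt]; last first.
  by rewrite hist_word_cons ?size_hist // IH.
by rewrite /hist_word /= rev_cons nth_rcons size_rev size_hist ltnn eqxx.
Qed.

(** The index [i] codes a triple [(k, e, v)]: the run passes through [v] at [k] and then loops
    through blocks [e]. There are countably many triples, and the only infinitary demand is that
    merging positions exist beyond every [n], which is Pi^0_2. *)
Lemma prophetic_sigma3 s : prophetic P ->
  exists d : nat -> nat -> seq X -> Prop,
  [/\ forall i n t q, d i n q -> d i n (t :: q),
      forall i m n q, m <= n -> d i n q -> d i m q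
    & forall x, P (cons_word s x) 0 <-> exists i, all_hit (d i) x].
Proof.
move=> [V F step acc out run r1 r2 r3 r4].
pose C := {ffun V -> V * {ffun F -> bool}}.
pose cnd (u : nat * C * V) n w b := let: (k, e, v) := u in
  [/\ out (seg step acc w 0 k v).1, fair_loop e v & exists j m,
    [/\ n <= j, k <= j, j <= m, m <= b &
        seg step acc w k j = e /\ seg step acc w k m = seg step acc w j m]].
have cnd_ext u n w w' b b' : b <= b' -> (forall i, i <= b -> w i = w' i) ->
    cnd u n w b -> cnd u n w' b'.
  case: u => -[k e] v bb' E [o fl [j [m [nj kj jm mb [c1 c2]]]]].
  have S i j' : j' <= b -> seg step acc w' i j' = seg step acc w i j'.
    move=> le; apply: seg_ext => l lt; symmetry; apply: E.
    exact: leq_trans (ltnW lt) le.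
  have jb := leq_trans jm mb; have kb := leq_trans kj jb.
  split=> //; first by rewrite S.
  by exists j, m; rewrite !S //; split=> //; apply: leq_trans bb'.
exists (fun i n q => if unpickle i is Some u then cnd u n (hist_word s q) (size q)
  else False); split=> [i n t q|i m n q mn|x].
- case: unpickle => // u; apply: cnd_ext => // i' le.
  by rewrite hist_word_cons.
- case: unpickle => // -[[k e] v] [o fl [j [m' [nj H]]]]; split=> //.
  by exists j, m'; split=> //; apply: leq_trans nj.
set w := cons_word s x; rewrite r4; split=> [out0|[i hit]]; last first.
  move: hit; rewrite /all_hit; case: unpickle => [[[k e] v]|] hit; last first.
    by case: (hit 0).
  have hit' n : exists b, cnd (k, e, v) n w b.
    have [b Hb] := hit n; exists b; apply: cnd_ext Hb; rewrite size_hist //.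
    exact: hist_wordE.
  have [_ [o fl _]] := hit' 0.
  have [|l [lS lf l0]] := @merging_run _ _ step acc w k e v fl.
    move=> n; have [b [_ _ [j [m [nj kj jm _ [c1 c2]]]]]] := hit' n.
    by exists j, m.
  by rewrite -(r3 w l lS lf) l0.
(* The run state belongs to the colour, so that merged positions carry the same state [v]; the
   pigeonhole principle then fixes the block [e] from [k]. *)
have [k kinf] := infinitely_merged (fun i m => (seg step acc w i m, run w i)).
have [e einf] := infinite_fiber (fun j => seg step acc w k j) kinf.
pose v := run w k.
have minf n : exists j m, [/\ n <= j, k <= j, j <= m, seg step acc w k j = e &
    seg step acc w k m = seg step acc w j m /\ run w j = v].
  have [j] := einf (maxn n k); rewrite geq_max => /andP[nj kj].
  move=> [[m [km jm [c1 c2]]] ej]; exists j, m; by split.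
exists (pickle (k, e, v)) => n; rewrite pickleK.
have [j [m [nj kj jm ej [c1 _]]]] := minf n.
exists m; apply: (cnd_ext _ _ w _ m); rewrite ?size_hist //.
  by move=> i le; rewrite hist_wordE.
split; first by rewrite (@seg_run _ _ step acc w _ (r1 w)).
- split.
    have [j' [_ [_ kj' _ <- [_ rj]]]] := minf 0.
    by rewrite -{1}rj (@seg_run _ _ step acc w _ (r1 w)).
  have [N NP] : exists N : F -> nat, forall f, k <= N f /\ acc f (run w (N f)).
    apply: (@fin_all_exists F (fun=> nat)
      (fun f n => k <= n /\ acc f (run w n))) => f; have [i] := r2 w f k; by exists i.
  (* Each [f] may use its own [j'], since the blocks from [k] to these positions are all equal to
     [e]. *)
  move=> f; have [j' [_ [le _ _ <- [_ <-]]]] := minf (N f).+1.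
  by have [kN a] := NP f; apply: (@seg_run_acc _ _ step acc w _ (r1 w) _ (N f)).
- by exists j, m.
Qed.

End Sigma3.

(** * Quantification prefixes *)

Section Skolem.
Context {Var : eqType}.
Implicit Types wp : seq (quantifier Var).

Definition upd D (v : Var -> D) x a : Var -> D := fun y => if y == x then a else v y.

(** Used over actions for a single move of the game, and over strategies for the classical
    semantics. *)
Fixpoint qsem D wp (v : Var -> D) (K : (Var -> D) -> Prop) : Prop :=
  match wp with
  | [::] => K v
  | QEx x :: wp' => exists a, qsem wp' (upd v x a) K
  | QAll x :: wp' => forall a, qsem wp' (upd v x a) K
  end.

Definition dual wp :=
  [seq match q with QEx x => QAll x | QAll x => QEx x end | q <- wp].

Lemma qvars_dual wp : qvars (dual wp) = qvars wp.
Proof. by rewrite /qvars -map_comp; apply: eq_map => -[]. Qed.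

Lemma exvars_sub wp : {subset exvars wp <= qvars wp}.
Proof.
move=> y; elim: wp => [|[x|x] wp IH] //=; rewrite !inE; last by move=> /IH ->; rewrite orbT.
by case/orP=> [->|/IH ->] //; rewrite orbT.
Qed.

Lemma univars_sub wp : {subset univars wp <= qvars wp}.
Proof.
move=> y; elim: wp => [|[x|x] wp IH] //=; rewrite !inE; first by move=> /IH ->; rewrite orbT.
by case/orP=> [->|/IH ->] //; rewrite orbT.
Qed.

Lemma univars_exvars wp y : uniq (qvars wp) -> y \in univars wp -> y \notin exvars wp.
Proof.
elim: wp => [|[x|x] wp IH] //= /andP[nx u].
  move=> yU; rewrite inE negb_or IH // andbT; apply: contraNneq nx => <-.
  exact: univars_sub.
rewrite inE => /predU1P[->|]; last exact: IH.
by apply: contra nx => /exvars_sub.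
Qed.

Lemma qvars_split wp y : y \in qvars wp -> y \notin exvars wp -> y \in univars wp.
Proof.
elim: wp => [|[x|x] wp IH] //=; rewrite !inE; first by case: eqP => //= _; apply: IH.
by case: eqP => //= _; apply: IH.
Qed.

Lemma dep_univars wp y : {subset dep wp y <= univars wp}.
Proof.
elim: wp => [|[x|x] wp IH] //= z; first by case: eqP => // _ /IH.
by rewrite !inE => /orP[->|/IH ->] //; rewrite orbT.
Qed.

Section Domain.
Variable D : Type.
Implicit Types (v : Var -> D) (K : (Var -> D) -> Prop) (F : (Var -> D) -> Var -> D).

Lemma qsem_mono wp v K K' :
  (forall u, K u -> K' u) -> qsem wp v K -> qsem wp v K'.
Proof.
move=> KK'; elim: wp v => [|[x|x] wp IH] v /=; first exact: KK'.
- by case=> a /IH; exists a.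
- by move=> H a; apply: IH.
Qed.

Lemma qsem_true (a0 : D) wp v : qsem wp v (fun=> True).
Proof. by elim: wp v => [|[x|x] wp IH] v //=; exists a0. Qed.

Lemma qsem_dual wp v K : qsem (dual wp) v (fun u => ~ K u) <-> ~ qsem wp v K.
Proof.
elim: wp v => [|[x|x] wp IH] v //=.
- split=> [H [a]|H a]; first by apply/IH.
  by apply/IH => Ha; apply: H; exists a.
- split=> [[a /IH Ha] H|H]; first exact: Ha.
  by have [a Ha] := not_all_ex_not _ _ H; exists a; apply/IH.
Qed.

Definition agree_off wp v v0 := forall y, y \notin qvars wp -> v y = v0 y.

(** The analogue of [dependence_map] on valuations of all variables, which allows induction on the
    prefix without subtypes. *)
Definition skolem wp F :=
  (forall v y, y \notin exvars wp -> F v y = v y) /\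
  (forall v1 v2 y, y \in exvars wp -> {in dep wp y, v1 =1 v2} -> F v1 y = F v2 y).

Lemma qsem_skolem wp v0 K : uniq (qvars wp) -> qsem wp v0 K ->
  exists F, skolem wp F /\ forall v, agree_off wp v v0 -> K (F v).
Proof.
elim: wp v0 => [|[x|x] wp IH] v0 /=.
- move=> _ H; exists id; split=> // v Hv; suff -> : v = v0 by [].
  by apply: functional_extensionality => y; apply: Hv.
- move=> /andP[nx u] [a /(IH _ u)[F [[F1 F2] F3]]].
  exists (fun v y => if y == x then a else F (upd v x a) y); split.
    split=> [v y|v1 v2 y]; rewrite inE ?negb_or.
      by case/andP=> /negbTE nyx /F1 ->; rewrite /upd nyx.
    case: (eqVneq y x) => //= nyx yE; rewrite eq_sym (negbTE nyx) => H.
    by apply: F2 => // z /H e; rewrite /upd e.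
  move=> v Hv; have Hv' : agree_off wp (upd v x a) (upd v0 x a).
    move=> y ny; rewrite /upd; case: eqP => // /eqP nyx.
    by apply: Hv; rewrite inE negb_or nyx.
  have -> : (fun y => if y == x then a else F (upd v x a) y) = F (upd v x a).
    apply: functional_extensionality => y; case: eqP => // ->.
    rewrite F1 ?/upd ?eqxx //; exact: contra (@exvars_sub _ _) nx.
  exact: F3.
- move=> /andP[nx u] H.
  have [F HF] := fun_choice (fun a F => skolem wp F /\
    forall v, agree_off wp v (upd v0 x a) -> K (F v)) (fun a => IH _ u (H a)).
  (* Skolem functions for the rest of the prefix are chosen separately for each value of [x]; this
     is how they come to depend on [x]. *)
  exists (fun v => F (v x) v); split.
    split=> [v y /(HF _).1.1 //|v1 v2 y yE E].
    rewrite (E x) ?mem_head //; apply: (HF _).1.2 => // z zd.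
    by apply: E; rewrite inE zd orbT.
  move=> v Hv; apply: (HF _).2 => y ny; rewrite /upd; case: eqP => [->//|/eqP nyx].
  by apply: Hv; rewrite inE negb_or nyx.
Qed.

Lemma skolem_qsem wp v0 K F : uniq (qvars wp) -> skolem wp F ->
  (forall v, agree_off wp v v0 -> K (F v)) -> qsem wp v0 K.
Proof.
elim: wp v0 F => [|[x|x] wp IH] v0 F /=.
- move=> _ [F1 _] H; suff <- : F v0 = v0 by apply: H.
  by apply: functional_extensionality => y; apply: F1.
- move=> /andP[nx u] [F1 F2] H.
  (* No universal variable precedes [x], so its value under [F] is constant and serves as the
     witness. *)
  have Fx v1 v2 : F v1 x = F v2 x.
    by apply: F2; rewrite ?mem_head // => z; rewrite /= eqxx.
  exists (F v0 x); apply: (IH _ (fun v y => if y == x then v x else F v y)) => //.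
    split=> [v y ny|v1 v2 y yE E].
      case: eqP => [->//|/eqP nyx]; apply: F1.
      by rewrite inE negb_or nyx.
    have nyx : y != x by apply: contraNneq nx => <-; apply: exvars_sub.
    rewrite (negbTE nyx); apply: F2; first by rewrite inE yE orbT.
    by move=> z; rewrite /= eq_sym (negbTE nyx); apply: E.
  move=> v Hv; suff -> : (fun y => if y == x then v x else F v y) = F v.
    apply: H => y; rewrite inE negb_or => /andP[nyx ny].
    by rewrite Hv // /upd (negbTE nyx).
  apply: functional_extensionality => y; case: eqP => // ->.
  by rewrite Hv // /upd eqxx (Fx v v0).
- move=> /andP[nx u] [F1 F2] H a.
  apply: (IH _ (fun v y => if y == x then v x else F (upd v x a) y)) => //.
    split=> [v y ny|v1 v2 y yE E].
      by case: eqP => [->//|/eqP nyx]; rewrite F1 // /upd (negbTE nyx).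
    have nyx : y != x by apply: contraNneq nx => <-; apply: exvars_sub.
    rewrite (negbTE nyx); apply: F2 => // z; rewrite inE /upd; case: eqP => //= _.
    exact: E.
  move=> v Hv; have vx : v x = a by rewrite Hv // /upd eqxx.
  suff -> : (fun y => if y == x then v x else F (upd v x a) y) = F v.
    apply: H => y; rewrite inE negb_or => /andP[nyx ny].
    by rewrite Hv // /upd (negbTE nyx).
  have -> : upd v x a = v.
    by apply: functional_extensionality => y; rewrite /upd; case: eqP => // ->.
  apply: functional_extensionality => y; case: eqP => // ->.
  by rewrite F1 //; apply: contra nx => /(@exvars_sub wp).
Qed.

Definition extend (v0 : Var -> D) (U : seq Var) (g : sub_of U -> D) : Var -> D :=
  fun y => if insub y is Some u then g u else v0 y.

Lemma extend_val v0 U (g : sub_of U -> D) u : extend v0 g (val u) = g u.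
Proof. by rewrite /extend valK. Qed.

Lemma extend_off v0 wp (g : sub_of (univars wp) -> D) :
  agree_off wp (extend v0 g) v0.
Proof.
by move=> y ny; rewrite /extend insubN //; apply: contra ny => /univars_sub.
Qed.

Lemma skolem_dependence v0 wp F : uniq (qvars wp) -> skolem wp F ->
  dependence_map (fun (g : sub_of (univars wp) -> D) (x : sub_of (qvars wp)) =>
    F (extend v0 g) (val x)).
Proof.
move=> u [F1 F2]; split=> [g x y e|g1 g2 x xE E].
  rewrite F1 e ?extend_val //; exact: univars_exvars (valP y).
apply: F2 => // z zd; have zU := dep_univars zd.
by have := E (Sub z zU) zd; rewrite -!(extend_val v0).
Qed.

Lemma dependence_skolem wp theta : uniq (qvars wp) -> @dependence_map _ wp D theta ->
  exists2 F, skolem wp F &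
  forall v, exists g, forall x, theta g x = F v (val x).
Proof.
move=> u [t1 t2].
pose restr v (y : sub_of (univars wp)) := v (val y).
exists (fun v y => if insub y is Some x then theta (restr v) x else v y).
  split=> [v y nyE|v1 v2 y yE E].
    case: insubP => // x xV e; have yU := qvars_split xV nyE.
    by rewrite (t1 _ x (Sub y yU)).
  case: insubP => [x xV e|]; last by rewrite exvars_sub.
  by apply: t2 => [|z zd]; rewrite ?e //; apply: E; rewrite -e.
by move=> v; exists (restr v) => x; rewrite valK.
Qed.

End Domain.
End Skolem.

(** * Plays and goals *)

Section Plays.
Context {AP Ag : finType} {G : CGS AP Ag}.

Lemma trk_eq (s : St G) (r r' : Trk s) : sval r = sval r' -> r = r'.
Proof.
by case: r r' => [p Hp] [p' Hp'] /= e; subst p'; rewrite (proof_irrelevance _ Hp Hp').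
Qed.

Lemma play_prefixS (s : St G) (c : Ag -> Str s) n :
  sval (play_prefix c n.+1) =
  rcons (sval (play_prefix c n))
    (trans G (lst (play_prefix c n)) (fun a => c a (play_prefix c n))).
Proof. by rewrite -cats1. Qed.

Lemma play_prefix_shift (s : St G) (c : Ag -> Str s) i j :
  sval (play_prefix c (i + j)) =
  sval (play_prefix c i) ++
  sval (play_prefix (fun a => str_shift (c a) (play_prefix c i)) j).
Proof.
elim: j => [|j IH]; first by rewrite addn0 /= cats0.
pose c' a := str_shift (c a) (play_prefix c i); rewrite -/c' in IH *.
rewrite addnS !play_prefixS -rcons_cat IH; congr rcons.
have e : play_prefix c (i + j) = trk_cat (play_prefix c' j) by apply: trk_eq.
by rewrite e /lst /= last_cat.
Qed.

Lemma lst_play_shift (s : St G) (c : Ag -> Str s) i j :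
  lst (play_prefix (fun a => str_shift (c a) (play_prefix c i)) j) =
  lst (play_prefix c (i + j)).
Proof. by rewrite [RHS]/lst play_prefix_shift last_cat. Qed.

Lemma hist_play (s : St G) (c : Ag -> Str s) n :
  hist (fun i => lst (play_prefix c i.+1)) n = rev (sval (play_prefix c n)).
Proof.
elim: n => //= n ->; rewrite -[_ ++ _]/(sval (play_prefix c n.+1)) play_prefixS.
by rewrite rev_rcons /lst -/(play_prefix c n.+1) play_prefixS last_rcons.
Qed.

Lemma head_rev_trk (s : St G) (r : Trk s) : head s (rev (sval r)) = lst r.
Proof.
by rewrite /lst; case/lastP: (sval r) => [|p t] //; rewrite rev_rcons last_rcons.
Qed.

End Plays.

Section PathFormulas.
Context {AP Ag : finType} {Var : eqType} {G : CGS AP Ag}.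
Implicit Types phi psi : SL AP Ag Var.

Lemma sat_agree phi (s : St G) (chi1 chi2 : asg Var s) :
  (forall v, v \in free phi -> chi1 v = chi2 v) -> sat phi chi1 -> sat phi chi2.
Proof.
have aL (X Y : seq (Var + Ag)) (t : St G) (x1 x2 : asg Var t) :
    (forall v : Var + Ag, v \in X ++ Y -> x1 v = x2 v) ->
    forall v : Var + Ag, v \in X -> x1 v = x2 v.
  by move=> E v vX; apply: E; rewrite mem_cat vX.
have aR (X Y : seq (Var + Ag)) (t : St G) (x1 x2 : asg Var t) :
    (forall v : Var + Ag, v \in X ++ Y -> x1 v = x2 v) ->
    forall v : Var + Ag, v \in Y -> x1 v = x2 v.
  by move=> E v vX; apply: E; rewrite mem_cat vX orbT.
elim: phi s chi1 chi2 => //=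
  [phi IH|phi IH psi IH'|phi IH psi IH'|phi IH|phi IH psi IH'|phi IH psi IH'
  |x phi IH|x phi IH|a x phi IH] s chi1 chi2 E.
- by move=> H /IH K; apply: H; apply: K => v /E.
- by case=> /(IH _ _ _ (aL _ _ _ _ _ E)) ? /(IH' _ _ _ (aR _ _ _ _ _ E)).
- by case=> [/(IH _ _ _ (aL _ _ _ _ _ E))|/(IH' _ _ _ (aR _ _ _ _ _ E))];
    [left|right].
- move=> [c [C H]]; exists c; split; first exact: complete_agree E C.
  exact: (holds_agree IH (aR _ _ _ _ _ E)).
- have /= E1 := aL _ _ _ _ _ (aR _ _ _ _ _ E).
  have /= E2 := aR _ _ _ _ _ (aR _ _ _ _ _ E).
  move=> [c [C [i [H1 H2]]]]; exists c; split; first exact: complete_agree E C.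
  exists i; split; first exact: (holds_agree IH' E2).
  by move=> j /H2; apply: (holds_agree IH E1).
- have /= E1 := aL _ _ _ _ _ (aR _ _ _ _ _ E).
  have /= E2 := aR _ _ _ _ _ (aR _ _ _ _ _ E).
  move=> [c [C H]]; exists c; split; first exact: complete_agree E C.
  move=> i; case: (H i) => [H1|[j [ji H1]]].
    by left; apply: (holds_agree IH' E2).
  by right; exists j; split=> //; apply: (holds_agree IH E1).
- case=> f Hf; exists f; apply: IH Hf => v vphi; rewrite /asg_upd.
  by case: eqP => // /eqP nv; apply: E; rewrite mem_filter nv.
- move=> H f; apply: IH (H f) => v vphi; rewrite /asg_upd.
  by case: eqP => // /eqP nv; apply: E; rewrite mem_filter nv.
- apply: IH => v vphi; rewrite /asg_upd; case: eqP => [ev|/eqP nv].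
    by apply: E; rewrite -ev vphi mem_head.
  by apply: E; case: ifP => // _; rewrite inE mem_filter nv vphi orbT.
Qed.

Lemma free_quant wp psi v :
  (v \in free (quant wp psi)) = (v \in free psi) && (v \notin [seq inl x | x <- qvars wp]).
Proof.
elim: wp => [|[x|x] wp IH] /=; first by rewrite andbT.
  by rewrite mem_filter IH inE negb_or; case: (v != _); rewrite ?andbF.
by rewrite mem_filter IH inE negb_or; case: (v != _); rewrite ?andbF.
Qed.

Lemma free_goal wp b phi v :
  is_qnt wp (free (bind b phi)) -> v \notin free (quant wp (bind b phi)).
Proof. by move=> [_ E]; rewrite free_quant E andbN. Qed.

Lemma free_bind_var b phi a x :
  uniq (unzip1 b) -> (a, x) \in b -> inr a \in free phi -> inl x \in free (bind b phi).
Proof.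
move=> ub axb aphi.
have agent b' : a \notin unzip1 b' -> inr a \in free (bind b' phi).
  elim: b' => [|[a' x'] b' IH] //=; rewrite inE negb_or => /andP[na /IH H].
  case: ifP => // _; rewrite inE mem_filter H andbT /=.
  by apply: contraNN na => /eqP[->].
elim: b ub axb => [|[a' x'] b IH] //= /andP[na' ub]; rewrite inE.
case/predU1P=> [[e1 e2]|axb]; first by subst a' x'; rewrite agent // mem_head.
have H := IH ub axb; case: ifP => // _.
by rewrite inE mem_filter H orbT.
Qed.

Lemma free_bind_nil b phi :
  (forall v, v \notin free phi) -> forall v, v \notin free (bind b phi).
Proof. by move=> H; elim: b => [|[a x] b IH] //= v; rewrite (negbTE (IH _)). Qed.

(** The dichotomy separates goals over sentences, whose bindings are vacuous, from goals in which
    every binding counts. *)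
Lemma OGSL_free phi : OGSL phi ->
  (forall x, inl x \notin free phi) /\
  ((forall v, v \notin free phi) \/ (forall a, inr a \in free phi)).
Proof.
have ag a : inr a \in (all_agents : seq (Var + Ag)) by rewrite map_f // mem_enum.
have nag x : inl x \notin (all_agents : seq (Var + Ag)) by apply/negP => /mapP[].
elim=> {phi} /=.
- by move=> p; split=> //; left.
- by [].
- move=> phi psi _ [n1 h1] _ [n2 h2]; split=> [x|]; first by rewrite mem_cat negb_or n1 n2.
  case: h1 => [h1|h1]; last by right=> a; rewrite mem_cat h1.
  case: h2 => [h2|h2]; last by right=> a; rewrite mem_cat h2 orbT.
  by left=> v; rewrite mem_cat negb_or h1 h2.
- move=> phi psi _ [n1 h1] _ [n2 h2]; split=> [x|]; first by rewrite mem_cat negb_or n1 n2.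
  case: h1 => [h1|h1]; last by right=> a; rewrite mem_cat h1.
  case: h2 => [h2|h2]; last by right=> a; rewrite mem_cat h2 orbT.
  by left=> v; rewrite mem_cat negb_or h1 h2.
- move=> phi _ [n1 _]; split=> [x|]; first by rewrite mem_cat negb_or nag n1.
  by right=> a; rewrite mem_cat ag.
- move=> phi psi _ [n1 _] _ [n2 _]; split=> [x|].
    by rewrite !mem_cat !negb_or nag n1 n2.
  by right=> a; rewrite mem_cat ag.
- move=> phi psi _ [n1 _] _ [n2 _]; split=> [x|].
    by rewrite !mem_cat !negb_or nag n1 n2.
  by right=> a; rewrite mem_cat ag.
- by move=> wp b phi _ _ _ q; split=> [x|]; [|left=> v]; apply: free_goal.
Qed.

(* Quantified and bound formulas are read as state predicates: in the one-goal
   fragment they are sentences. *)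
Fixpoint ltl phi (w : nat -> St G) (i : nat) : Prop :=
  match phi with
  | Atom p => p \in lab G (w i)
  | Neg phi => ~ ltl phi w i
  | And phi psi => ltl phi w i /\ ltl psi w i
  | Or phi psi => ltl phi w i \/ ltl psi w i
  | Next phi => next_p (ltl phi) w i
  | Until phi psi => until_p (ltl phi) (ltl psi) w i
  | Release phi psi => release_p (ltl phi) (ltl psi) w i
  | Exq _ _ | Allq _ _ | Bind _ _ _ => sat phi (fun=> None : option (Str (w i)))
  end.

Lemma prophetic_ltl phi : prophetic (ltl phi).
Proof.
elim: phi => [p|phi H|phi H psi H'|phi H psi H'|phi H|phi H psi H'|phi H psi H'
  |x phi _|x phi _|a x phi _].
- exact: (prophetic_state (fun t : St G => p \in lab G t)).
- exact: prophetic_not.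
- exact: prophetic_and.
- exact: prophetic_or.
- exact: prophetic_next.
- exact: prophetic_until.
- exact: prophetic_release.
- exact: (prophetic_state (fun t => sat (Exq x phi) (fun=> None : option (Str t)))).
- exact: (prophetic_state (fun t => sat (Allq x phi) (fun=> None : option (Str t)))).
- exact: (prophetic_state (fun t => sat (Bind a x phi) (fun=> None : option (Str t)))).
Qed.

(** [Ag] is non-empty, so a goal starts with a quantifier or a binding and falls under the last
    clause of [ltl]. *)
Lemma ltl_goal wp b phi w i : is_bnd b ->
  ltl (quant wp (bind b phi)) w i =
  sat (quant wp (bind b phi)) (fun=> None : option (Str (w i))).
Proof.
case: wp => [|[] x wp] //; case: b => [|[a x] b] //= [] /= e.
by have := Ag_nonempty G; rewrite -e.
Qed.

Lemma complete_unique (s : St G) (chi : asg Var s) c c' :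
  complete_by chi c -> complete_by chi c' -> c = c'.
Proof.
move=> C C'; apply: functional_extensionality => a.
by have := C a; rewrite C' => -[].
Qed.

Lemma sat_ltl phi (s : St G) (chi : asg Var s) c w k : OGSL phi ->
  complete_by chi c -> (forall n, w (k + n) = lst (play_prefix c n)) ->
  sat phi chi <-> ltl phi w k.
Proof.
move=> H; elim: H s chi c w k => {phi}
  [p|phi _ IH|phi psi _ IH _ IH'|phi psi _ IH _ IH'|phi _ IH|phi psi _ IH _ IH'
  |phi psi _ IH _ IH'|wp b phi _ _ bb qq] s chi c w k C Hw.
- by have := Hw 0; rewrite addn0 /= => ->.
- by rewrite /= (IH _ _ _ _ _ C Hw).
- by rewrite /= (IH _ _ _ _ _ C Hw) (IH' _ _ _ _ _ C Hw).
- by rewrite /= (IH _ _ _ _ _ C Hw) (IH' _ _ _ _ _ C Hw).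
1-3: have Cs i : complete_by (asg_shift chi (play_prefix c i))
       (fun a => str_shift (c a) (play_prefix c i))
       by move=> a; rewrite /asg_shift C.
1-3: have Hs i n : w (k + i + n) = lst (play_prefix
       (fun a => str_shift (c a) (play_prefix c i)) n)
       by rewrite lst_play_shift -Hw addnA.
1-3: have L i : holds_at (sat phi) chi c i <-> ltl phi w (k + i)
       by apply: IH (Cs i) (Hs i).
- rewrite /= /next_p -addn1 -L; split=> [[c' [C' H]]|H]; last by exists c.
  by rewrite (complete_unique C C').
- have L' i : holds_at (sat psi) chi c i <-> ltl psi w (k + i)
    by apply: IH' (Cs i) (Hs i).
  split=> [[c' [C' [i [H1 H2]]]]|[i [/L' H1 H2]]].
    rewrite -(complete_unique C C') in H1 H2.
    by exists i; split=> [|j lt]; [apply/L' | apply/L/H2].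
  by exists c; split=> //; exists i; split=> // j lt; apply/L/H2.
- have L' i : holds_at (sat psi) chi c i <-> ltl psi w (k + i)
    by apply: IH' (Cs i) (Hs i).
  split=> [[c' [C' H]] i|H].
    rewrite -(complete_unique C C') in H.
    by case: (H i) => [/L'|[j [lt /L]]]; [left | right; exists j].
  exists c; split=> // i.
  by case: (H i) => [/L'|[j [lt /L]]]; [left | right; exists j].
(* A goal is a sentence, so [chi] may be replaced by the empty assignment. *)
- rewrite ltl_goal //; have -> : w k = s by have := Hw 0; rewrite addn0.
  by split; apply: sat_agree => v vf; have := free_goal v qq; rewrite vf.
Qed.

Fixpoint bind_asg (s : St G) (b : seq (Ag * Var)) (chi : asg Var s) : asg Var s :=
  if b is p :: b' then bind_asg b' (asg_upd chi (inr p.1) (chi (inl p.2))) else chi.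

Lemma sat_bind b phi (s : St G) (chi : asg Var s) :
  sat (bind b phi) chi = sat phi (bind_asg b chi).
Proof. by elim: b chi => //= p b IH chi; rewrite IH. Qed.

Lemma satE_bind b phi (s : St G) (chi : asg Var s) :
  satE (bind b phi) chi = satE phi (bind_asg b chi).
Proof. by elim: b chi => //= p b IH chi; rewrite -IH. Qed.

Lemma bind_asg_agent b (s : St G) (chi : asg Var s) a x :
  uniq (unzip1 b) -> (a, x) \in b -> bind_asg b chi (inr a) = chi (inl x).
Proof.
have other b' (chi' : asg Var s) : a \notin unzip1 b' ->
    bind_asg b' chi' (inr a) = chi' (inr a).
  elim: b' chi' => [|p b' IH] chi' //=; rewrite inE negb_or => /andP[na /IH ->].
  by rewrite /asg_upd; case: eqP => // -[e]; rewrite e eqxx in na.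
elim: b chi => [|[a' x'] b IH] //= chi /andP[na ub]; rewrite inE.
case/predU1P=> [[e1 e2]|axb]; first by subst a' x'; rewrite other // /asg_upd eqxx.
by rewrite IH.
Qed.

End PathFormulas.

(** * A single goal as a game on tracks *)

Section Goal.
Context {AP Ag : finType} {Var : eqType} {G : CGS AP Ag}.
Variables (s : St G) (beta : Ag -> Var).
Implicit Types (wp : seq (quantifier Var)) (S : seq (St G) -> Prop).

Definition next_state (q : seq (St G)) (u : Var -> Ac G) : St G :=
  trans G (head s q) (fun a => u (beta a)).

Definition profile (v : Var -> Str s) : Ag -> Str s := fun a => v (beta a).

(** Skolem functions over strategies assembled from Skolem functions over actions, one family for
    each track: this is the elementary form. *)
Definition pointwise (Fr : Trk s -> (Var -> Ac G) -> Var -> Ac G)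
    (v : Var -> Str s) : Var -> Str s :=
  fun y r => Fr r (fun z => v z r) y.

Lemma pointwise_skolem wp Fr : (forall r, skolem wp (Fr r)) -> skolem wp (pointwise Fr).
Proof.
move=> HF; split=> [v y ny|v1 v2 y yE E]; apply: functional_extensionality => r.
  by rewrite /pointwise (HF r).1.
by apply: (HF r).2 => // z /E ->.
Qed.

Lemma local_strategies wp S (a0 : Ac G) : uniq (qvars wp) -> S [::] ->
  (forall q, S q -> qsem wp (fun=> a0) (fun u => S (next_state q u :: q))) ->
  exists2 Fr, forall r, skolem wp (Fr r) &
    forall v, agree_off wp v (fun _ _ => a0) ->
    forall n, S (rev (sval (play_prefix (profile (pointwise Fr v)) n))).
Proof.
move=> uq S0 Scl.
(* The premise makes the requirement satisfiable on tracks outside [S] too, so that Skolem functions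
   can be chosen for all tracks. *)
pose K (r : Trk s) u := S (rev (sval r)) -> S (next_state (rev (sval r)) u :: rev (sval r)).
have [Fr HF] : exists Fr : Trk s -> (Var -> Ac G) -> Var -> Ac G, forall r,
    skolem wp (Fr r) /\ forall u, agree_off wp u (fun=> a0) -> K r (Fr r u).
  apply: (fun_choice (fun r F =>
    skolem wp F /\ forall u, agree_off wp u (fun=> a0) -> K r (F u))) => r.
  apply: qsem_skolem => //; case: (classic (S (rev (sval r)))) => [Sr|nS].
    by apply: qsem_mono (Scl _ Sr) => u Su _.
  by apply: qsem_mono (qsem_true a0 wp _) => u _ /nS.
exists Fr => [r|v Hv]; first by have [] := HF r.
elim=> [|n IH] //; rewrite play_prefixS rev_rcons.
set r := play_prefix _ n in IH *.
have [_ /(_ (fun z => v z r))] := HF r; rewrite /K /next_state head_rev_trk; apply=> //.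
by move=> y ny; rewrite Hv.
Qed.

Variable phi : SL AP Ag Var.

Definition outcome (v : Var -> Str s) : Prop :=
  ltl phi (fun n => lst (play_prefix (profile v) n)) 0.

Lemma outcome_hist v :
  outcome v <-> ltl phi (cons_word s (fun n => lst (play_prefix (profile v) n.+1))) 0.
Proof.
rewrite /outcome; set w := (X in ltl phi X 0); set w' := cons_word _ _.
suff -> : w = w' by [].
by apply: functional_extensionality => -[].
Qed.

(** By determinacy it suffices to exclude a winning strategy of the opponent. Such a strategy would
    give Skolem functions over strategies for the dual prefix, and these refute the classical truth
    of the goal. *)
Lemma goal_determinacy wp (a0 : Ac G) : uniq (qvars wp) ->
  qsem wp (fun _ _ => a0) outcome ->
  exists2 Fr, forall r, skolem wp (Fr r) &
    forall v, agree_off wp v (fun _ _ => a0) -> outcome (pointwise Fr v).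
Proof.
move=> uq sem.
pose E q X := qsem wp (fun=> a0) (fun u => X (next_state q u)).
have E_mono q (P Q : St G -> Prop) : (forall t, P t -> Q t) -> E q P -> E q Q.
  by move=> PQ; apply: qsem_mono => u; apply: PQ.
have E_top q : E q (fun=> True) by apply: qsem_true.
have [d [d_up d_down dP]] := prophetic_sigma3 s (prophetic_ltl phi).
have [[S [S0 Scl Spl]]|[S [S0 Scl Spl]]] := sigma3_determinacy E_mono E_top d_up d_down dP.
  have [Fr HF HS] := local_strategies uq S0 Scl.
  exists Fr => // v Hv; apply/outcome_hist/Spl => n.
  by rewrite hist_play; apply: HS.
(* The first player being unable to leave [S] means, by duality of the prefix, that the dual prefix
   over actions keeps the play in [S]. *)
have dcl q : S q -> qsem (dual wp) (fun=> a0) (fun u => S (next_state q u :: q)).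
  move=> /Scl /qsem_dual; apply: qsem_mono => u; exact: NNPP.
have uq' : uniq (qvars (dual wp)) by rewrite qvars_dual.
have [Fr HF HS] := local_strategies uq' S0 dcl.
suff: ~ qsem wp (fun _ _ => a0) outcome by [].
apply/qsem_dual; apply: (skolem_qsem uq' (pointwise_skolem HF)) => v Hv /outcome_hist.
by apply: Spl => n; rewrite hist_play; apply: HS.
Qed.

Variable b : seq (Ag * Var).
Hypothesis (ub : uniq (unzip1 b)) (betaP : forall a, (a, beta a) \in b).
Hypothesis og : OGSL phi.

Lemma bind_complete (chi : asg Var s) v :
  (forall a, chi (inl (beta a)) = Some (v (beta a))) ->
  complete_by (bind_asg b chi) (profile v).
Proof. by move=> H a; rewrite (bind_asg_agent _ ub (betaP a)). Qed.

Lemma sat_bind_outcome (chi : asg Var s) v :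
  (forall a, chi (inl (beta a)) = Some (v (beta a))) ->
  sat (bind b phi) chi <-> outcome v.
Proof. by move=> /bind_complete C; rewrite sat_bind; apply: sat_ltl C _. Qed.

(** The disjunction is the induction invariant: a variable used by an agent is either still to be
    quantified or already has its value in [v]. *)
Lemma sat_quant_qsem wp (chi : asg Var s) v :
  (forall a, beta a \in qvars wp \/ chi (inl (beta a)) = Some (v (beta a))) ->
  sat (quant wp (bind b phi)) chi <-> qsem wp v outcome.
Proof.
elim: wp chi v => [|q wp IH] chi v H /=.
  by apply: sat_bind_outcome => a; case: (H a).
have H' x f : x = qvar q -> forall a, beta a \in qvars wp \/
    asg_upd chi (inl x) (Some f) (inl (beta a)) = Some (upd v x f (beta a)).
  move=> e a; rewrite /asg_upd /upd [inl _ == _]/eq_op /=.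
  case: eqP => [_|/eqP n]; first by right.
  by case: (H a); [rewrite inE -e (negbTE n); left | right].
case: q H H' => x H H' /=.
  by split=> -[f Hf]; exists f; move: Hf; rewrite (IH _ (upd v x f)) //; apply: H'.
by split=> Hf f; move: (Hf f); rewrite (IH _ (upd v x f)) //; apply: H'.
Qed.

Lemma asg_of_var (X : seq Var) (f : sub_of X -> Str s) (v : Var -> Str s) x :
  (forall y, f y = v (val y)) -> x \in X -> asg_of f (inl x) = Some (v x).
Proof. by move=> H xX; rewrite /asg_of insubT /= H. Qed.

Theorem sat_goal_elementary wp (chi : asg Var s) :
  uniq (qvars wp) -> (forall a, beta a \in qvars wp) ->
  sat (quant wp (bind b phi)) chi <-> elementary_sem (@sat _ _ _ G (bind b phi)) wp s.
Proof.
move=> uq bq; have [a0] := Ac_nonempty G.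
rewrite (@sat_quant_qsem wp chi (fun _ _ => a0)); last by left.
split=> [/(goal_determinacy uq)[Fr HF HS]|[theta [dm _ Hth]]].
- exists (fun g x => pointwise Fr (extend (fun _ _ => a0) g) (val x)); split.
  + exact: skolem_dependence uq (pointwise_skolem HF).
  (* At the track [r] the map applies [Fr r], which sees only the actions chosen at [r]. *)
  + exists (fun r h x => Fr r (extend (fun=> a0) h) (val x)) => g x r.
    rewrite /pointwise; congr (Fr r _ _); apply: functional_extensionality => y.
    by rewrite /extend; case: insub.
  + move=> g; apply/(@sat_bind_outcome _ (pointwise Fr (extend (fun _ _ => a0) g))).
      by move=> a; apply: asg_of_var.
    by apply: HS; apply: extend_off.
- have [F HF HFt] := dependence_skolem uq dm.
  apply: (skolem_qsem uq HF) => v _; have [g Hg] := HFt v.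
  by have := Hth g; rewrite (@sat_bind_outcome _ (F v)) // => a; apply: asg_of_var.
Qed.

End Goal.

(** * Equivalence of the two semantics *)

Lemma holds_at_equiv (AP Ag : finType) (Var : eqType) (G : CGS AP Ag)
    (X : seq (Var + Ag)) (P Q : forall t : St G, asg Var t -> Prop)
    (s : St G) (chi : asg Var s) c i :
  (forall t (chi' : asg Var t), {subset X <= asg_dom chi'} -> P t chi' <-> Q t chi') ->
  {subset X <= asg_dom chi} -> holds_at P chi c i <-> holds_at Q chi c i.
Proof.
move=> PQ dom; apply: PQ => v /dom; rewrite !unfold_in /asg_dom /asg_shift.
by case: (chi v).
Qed.

Theorem theorem4p24 (AP Ag : finType) (Var : eqType) (G : CGS AP Ag)
    (phi : SL AP Ag Var) (s : St G) (chi : asg Var s) :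
  OGSL phi ->
  {subset free phi <= asg_dom chi} ->
  sat phi chi <-> satE phi chi.
Proof.
move=> H; elim: H s chi => {phi}
  [p|phi _ IH|phi psi _ IH _ IH'|phi psi _ IH _ IH'|phi _ IH|phi psi _ IH _ IH'
  |phi psi _ IH _ IH'|wp b phi og IH bb qq] s chi dom //.
- by change (~ sat phi chi <-> ~ satE phi chi); rewrite (IH _ _ dom).
- have E : sat phi chi <-> satE phi chi.
    by apply: IH => v h; apply: dom; rewrite mem_cat h.
  have E' : sat psi chi <-> satE psi chi.
    by apply: IH' => v h; apply: dom; rewrite mem_cat h orbT.
  by split=> -[/E h /E' h'].
- have E : sat phi chi <-> satE phi chi.
    by apply: IH => v h; apply: dom; rewrite mem_cat h.
  have E' : sat psi chi <-> satE psi chi.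
    by apply: IH' => v h; apply: dom; rewrite mem_cat h orbT.
  by split=> -[/E h|/E' h]; [left|right|left|right].
- have E c i : holds_at (sat phi) chi c i <-> holds_at (satE phi) chi c i.
    by apply: (holds_at_equiv _ _ IH) => v h; apply: dom; rewrite mem_cat h orbT.
  by split=> -[c [C /E h]]; exists c.
- have E c i : holds_at (sat phi) chi c i <-> holds_at (satE phi) chi c i.
    by apply: (holds_at_equiv _ _ IH) => v h; apply: dom; rewrite !mem_cat h orbT.
  have E' c i : holds_at (sat psi) chi c i <-> holds_at (satE psi) chi c i.
    by apply: (holds_at_equiv _ _ IH') => v h; apply: dom; rewrite !mem_cat h !orbT.
  by split=> -[c [C [i [/E' h h']]]]; exists c; split=> //; exists i; split=> // j /h' /E.
- have E c i : holds_at (sat phi) chi c i <-> holds_at (satE phi) chi c i.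
    by apply: (holds_at_equiv _ _ IH) => v h; apply: dom; rewrite !mem_cat h orbT.
  have E' c i : holds_at (sat psi) chi c i <-> holds_at (satE psi) chi c i.
    by apply: (holds_at_equiv _ _ IH') => v h; apply: dom; rewrite !mem_cat h !orbT.
  split=> -[c [C h]]; exists c; split=> // i;
    by case: (h i) => [/E'|[j [lt /E]]]; [left|right; exists j].
have ub : uniq (unzip1 b).
  by apply: count_mem_uniq => a; rewrite bb.2 -has_pred1 has_count bb.2.
(* If [phi] is a sentence, the bindings add no free variable and the prefix is empty. Otherwise all
   agents are free in [phi], and the variable of each agent is quantified by [wp]. *)
have [_ [nofree|allfree]] := OGSL_free og.
  have e : wp = [::].
    case: wp qq {dom} => // q wp [_ E]; have := free_bind_nil b nofree (inl (qvar q)).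
    by rewrite -E mem_head.
  rewrite e /= sat_bind satE_bind; apply: IH => v vf.
  by have := nofree v; rewrite vf.
have [beta betaP] : exists beta : Ag -> Var, forall a, (a, beta a) \in b.
  apply: (@fin_all_exists _ (fun=> Var) (fun a x => (a, x) \in b)) => a.
  have /mapP[[a' x] ab -> /=] : a \in unzip1 b by rewrite -has_pred1 has_count bb.2.
  by exists x.
have bq a : beta a \in qvars wp.
  have := free_bind_var ub (betaP a) (allfree a); rewrite -qq.2 => /mapP[x xq [->]].
  exact: xq.
rewrite satE_goal // (sat_goal_elementary ub betaP og chi qq.1 bq).
(* After the bindings every agent has a strategy from [f], so the induction hypothesis applies to
   [phi]. *)
have E (f : sub_of (qvars wp) -> Str s) :
    sat (bind b phi) (asg_of f) <-> satE (bind b phi) (asg_of f).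
  rewrite sat_bind satE_bind; apply: IH => -[x|a] vf.
    by have := (OGSL_free og).1 x; rewrite vf.
  by rewrite unfold_in /asg_dom (bind_asg_agent _ ub (betaP a)) /= insubT.
by split=> -[theta [dm el h]]; exists theta; split=> // v; apply/E.
Qed.
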